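(* Let $K=(\mathcal V,\mathcal E)$ be a connected, locally finite graph with weights $c$ on vertices and $r$ on edges. If $K$ is $\chi$-complete, then the Laplacian $\Delta=D^2$, with domain $C_0^0(K)\oplus C_0^1(K)$, is essentially self-adjoint in $\mathcal H=L_2(\mathcal V)\oplus L_2(\mathcal E)$.
   Context: A graph $K=(\mathcal V,\mathcal E)$ consists of a set $\mathcal V$ of vertices and a set $\mathcal E\subset\mathcal V\times\mathcal V$ of oriented edges, which is symmetric ($(v_1,v_2)\in\mathcal E\Rightarrow(v_2,v_1)\in\mathcal E$) and without loops. For $e=(v_1,v_2)\in\mathcal E$ put $e^-=v_1$, $e^+=v_2$, $-e=(v_2,v_1)$. $K$ is connected if any two vertices are joined by a finite path of edges, and locally finite if each vertex belongs to finitely many edges. Weights: $c:\mathcal V\to(0,\infty)$ and $r:\mathcal E\to(0,\infty)$ with $r(-e)=r(e)$. $C^0(K)=\mathbb C^{\mathcal V}$; $C^1(K)=\{\varphi:\mathcal E\to\mathbb C:\ \varphi(-e)=-\varphi(e)\}$; $C_0^0(K)$, $C_0^1(K)$ are the subspaces of finitely supported elements. Inner products: $\langle f,g\rangle=\sum_{v\in\mathcal V}c(v)f(v)\overline{g(v)}$ and $\langle\varphi,\psi\rangle=\frac12\sum_{e\in\mathcal E}r(e)\varphi(e)\overline{\psi(e)}$; $L_2(\mathcal V)$, $L_2(\mathcal E)$ are the Hilbert spaces of elements of $C^0(K)$, $C^1(K)$ of finite norm. Operators: $d f(e)=f(e^+)-f(e^-)$ and $\delta\varphi(x)=\frac{1}{c(x)}\sum_{e\in\mathcal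 E,\,e^+=x}r(e)\varphi(e)$. $D(f,\varphi)=(\delta\varphi,df)$ maps $C_0^0(K)\oplus C_0^1(K)$ to itself, and $\Delta=D^2$ on this domain. $K$ is $\chi$-complete if there is an increasing sequence of finite sets $(B_n)_{n\in\mathbb N}$ with $\mathcal V=\bigcup_n B_n$ and functions $\chi_n$ such that: (i) $\chi_n\in C_0^0(K)$, $0\le\chi_n\le1$; (ii) $v\in B_n\Rightarrow\chi_n(v)=1$; (iii) there is $C>0$ such that for all $n\in\mathbb N$ and $x\in\mathcal V$, $\frac{1}{c(x)}\sum_{e:\ e^+=x\text{ or }e^-=x}r(e)\,(d\chi_n(e))^2\le C$. *)

(* Defs.v *)
From mathcomp Require Import all_boot all_order all_algebra.
From mathcomp Require Import all_classical all_reals all_analysis.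
From mathcomp Require Import complex.
From mathcomp Require summability.
Import Order.TTheory GRing.Theory Num.Theory.
Import numFieldNormedType.Exports.

Set Implicit Arguments.
Unset Strict Implicit.
Unset Printing Implicit Defensive.

Local Open Scope classical_set_scope.
Local Open Scope ring_scope.
Local Open Scope complex_scope.

Section operators.
(* Unbounded operators in a Hilbert space whose vectors are the elements of a
   subset [H] of an additive group [U], with inner product [dot] (a total
   function on [U], meaningful on [H]).  An operator is identified with its
   graph, a set of pairs. *)
Context {R : realType} {U : zmodType} (H : set U) (dot : U -> U -> R[i]).

Definition hnorm (u : U) : R := Num.sqrt (complex.Re (dot u u)).

Definition dense_in (D : set U) : Prop :=
  D `<=` H /\
  forall u, H u -> forall eps : R, 0 < eps -> exists2 x, D x & hnorm (u - x) < eps.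

Definition op_graph (D : set U) (A : U -> U) : set (U * U) :=
  [set (x, A x) | x in D].

Definition op_dom (G : set (U * U)) : set U := fst @` G.

Definition op_closure (G : set (U * U)) : set (U * U) :=
  [set p | [/\ H p.1, H p.2 &
    forall eps : R, 0 < eps ->
      exists q, [/\ G q, hnorm (p.1 - q.1) < eps & hnorm (p.2 - q.2) < eps]]].

Definition op_adjoint (G : set (U * U)) : set (U * U) :=
  [set p | [/\ H p.1, H p.2 &
    forall q, G q -> dot q.2 p.1 = dot q.1 p.2]].

Definition selfadjoint (G : set (U * U)) : Prop :=
  dense_in (op_dom G) /\ op_adjoint G = G.

(* Closability is not a separate clause: the adjoint of a densely defined
   relation is single-valued. *)
Definition essentially_selfadjoint (G : set (U * U)) : Prop :=
  [/\ G `<=` H `*` H, dense_in (op_dom G) & selfadjoint (op_closure G)].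

End operators.

Record graph (V : choiceType) := Graph {
  edge_set : set (V * V);
  edge_sym : forall v w, edge_set (v, w) -> edge_set (w, v);
  edge_irr : forall v, ~ edge_set (v, v) }.

Section graphs.
Context {V : choiceType} (K : graph V).

(* The type of oriented edges; [etail e] is e^-, [ehead e] is e^+ and
   [eopp e] is -e. *)
Definition edge : choiceType := set_type (edge_set K).

Definition etail (e : edge) : V := (val e).1.
Definition ehead (e : edge) : V := (val e).2.

Lemma eopp_subproof (e : edge) : (ehead e, etail e) \in edge_set K.
Proof.
rewrite inE; apply: edge_sym; rewrite /etail /ehead -surjective_pairing.
exact: set_mem (valP e).
Qed.

Definition eopp (e : edge) : edge := Sub (ehead e, etail e) (eopp_subproof e).

Definition connected_graph : Prop := forall v w : V,
  exists2 s : seq V, path [rel x y | (x, y) \in edge_set K] v s & last v s = w.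

Definition edges_at (x : V) : set edge := [set e | ehead e = x \/ etail e = x].

Definition locally_finite : Prop := forall x : V, finite_set (edges_at x).

Definition coboundary {A : zmodType} (f : V -> A) (e : edge) : A :=
  f (ehead e) - f (etail e).

End graphs.

Arguments edges_at {V} K x.

Definition finitely_supported {T : Type} {A : zmodType} (f : T -> A) : Prop :=
  finite_set [set t | f t != 0].

Section weighted_l2.
Context {R : realType} {T : choiceType} (w : T -> R).

Definition l2 : set (T -> R[i]) :=
  [set f | (\esum_(t in [set: T]) (w t * Normc.normc (f t) ^+ 2)%:E < +oo)%E].

(* [summability.sum] is the limit of the net of finite partial sums; the [^o]
   selects the normed-module structure of R[i] over itself. *)
Definition l2dot (f g : T -> R[i]) : R[i] :=
  summability.sum (fun t => (w t)%:C * f t * (g t)^* : R[i]^o).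

End weighted_l2.

Section weighted_graphs.
Context {R : realType} {V : choiceType} (K : graph V).
Context (c : V -> R) (r : edge K -> R).

Definition C1 : set (edge K -> R[i]) :=
  [set phi | forall e, phi (eopp e) = - phi e].

(* On a locally finite graph the index set is finite. *)
Definition delta (phi : edge K -> R[i]) (x : V) : R[i] :=
  ((c x)^-1)%:C * \sum_(e \in [set e | ehead e = x]) (r e)%:C * phi e.

(* Elements of C^0(K) (+) C^1(K) are pairs whose second component is in [C1]. *)
Definition cochain : zmodType := ((V -> R[i]) * (edge K -> R[i]))%type.

Definition gauss_bonnet (u : cochain) : cochain :=
  (delta u.2, coboundary u.1).

Definition laplacian (u : cochain) : cochain := gauss_bonnet (gauss_bonnet u).

Definition cochain_fin : set cochain :=
  [set u | [/\ finitely_supported u.1, C1 u.2 & finitely_supported u.2]].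

Definition cochain_l2 : set cochain :=
  [set u | [/\ l2 c u.1, C1 u.2 & l2 r u.2]].

Definition cochain_dot (u v : cochain) : R[i] :=
  l2dot c u.1 v.1 + 2^-1 * l2dot r u.2 v.2.

Definition chi_complete : Prop :=
  exists (B : nat -> set V) (chi : nat -> V -> R),
  [/\ [/\ forall n, finite_set (B n),
          forall m n, (m <= n)%N -> B m `<=` B n &
          \bigcup_n B n = [set: V]],
      forall n, finitely_supported (chi n) /\ (forall v, 0 <= chi n v <= 1),
      forall n v, B n v -> chi n v = 1 &
      exists2 M : R, 0 < M & forall n x,
        (c x)^-1 * \sum_(e \in edges_at K x) r e * coboundary (chi n) e ^+ 2 <= M].

End weighted_graphs.

Arguments cochain_fin R {V} K.

(* Main.v *)
(* Since Delta is positive, it is essentially self-adjoint as soon as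
   ker (Delta^* + 1) = 0. Let u = (f, phi) satisfy Delta^* u = -u, and cut it
   off to q_n = (chi_n^2 f, omega_n phi), where omega_n(e) =
   chi_n(e^+) chi_n(e^-). By Green's formula <q_n, u> = -<D q_n, D u>, and the
   terms of <D q_n, D u> quadratic in D u complete to squares:
   Re <D q_n, D u> is bounded below by minus a sum of |u|^2 weighted by
   m_n(x) = c(x)^-1 sum_(e^+ = x) r(e) (d chi_n(e))^2. As m_n is bounded and
   tends to 0 pointwise, dominated convergence gives <q_n, u> -> 0, whence
   u = 0. *)
Require Import Defs.
From mathcomp Require Import all_boot all_order all_algebra finmap.
From mathcomp Require Import all_classical all_reals all_analysis.
From mathcomp Require Import complex.
From mathcomp Require Import ring lra.
From mathcomp Require summability.
Import Order.TTheory GRing.Theory Num.Theory.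
Import numFieldNormedType.Exports.

Set Implicit Arguments.
Unset Strict Implicit.
Unset Printing Implicit Defensive.

Local Open Scope classical_set_scope.
Local Open Scope ring_scope.
Local Open Scope complex_scope.

(** * Hilbert spaces and positive operators *)

(** The obstacle is that [u] has finite norm but [D u] need not, so the error made by cutting off
    cannot be estimated by |u| |D u|. Completing squares gets around this: every term containing
    [D u] becomes a nonnegative square or is absorbed by one, and what is left to pay involves |u|^2
    alone. [D u] itself makes sense pointwise by local finiteness, and Green's formula asks for
    finite support of one argument only, so no regularity of [u] has to be established. The shift by
    1, rather than by the imaginary unit, makes a bound on a real part sufficient: <q_n, u> is a sum
    of nonnegative terms, so it dominates the weighted |u|^2 at any single point where the cutoff
    factor is 1. The m_n tend to 0 pointwise because chi_n is eventually 1 at x and at each of its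
    finitely many neighbours, so that m_n(x) is eventually equal to 0. *)

Section complex_parts.
Context {R : realType}.
Implicit Types (x y : R[i]) (a : R).

Lemma ReD x y : complex.Re (x + y) = complex.Re x + complex.Re y.
Proof. by case: x; case: y. Qed.

Lemma ImD x y : complex.Im (x + y) = complex.Im x + complex.Im y.
Proof. by case: x; case: y. Qed.

Lemma ReN x : complex.Re (- x) = - complex.Re x.
Proof. by case: x. Qed.

Lemma ImN x : complex.Im (- x) = - complex.Im x.
Proof. by case: x. Qed.

Lemma Re_realM a x : complex.Re (a%:C * x) = a * complex.Re x.
Proof. by case: x => p q /=; rewrite mul0r subr0. Qed.

Lemma ReJ x : complex.Re (Num.conj x) = complex.Re x.
Proof. by case: x. Qed.

Lemma conj_real a : Num.conj a%:C = a%:C.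
Proof. exact: conjc_real. Qed.

End complex_parts.

Section hilbert_spaces.
Context {R : realType} {U : lmodType R[i]} (H : set U) (dot : U -> U -> R[i]).

Definition nsq (u : U) : R := complex.Re (dot u u).

(** The axioms are relativised to [H] because [dot] is total and carries no meaning outside [H].
    Completeness is phrased with squared norms, which avoids both roots and a topology on [U]. *)
Record is_hilbert : Prop := IsHilbert {
  hilbert0 : H 0;
  hilbertD : forall u v, H u -> H v -> H (u + v);
  hilbertZ : forall a u, H u -> H (a *: u);
  hilbert_dotDl : forall u v z, H u -> H v -> H z ->
    dot (u + v) z = dot u z + dot v z;
  hilbert_dotZl : forall a u v, H u -> H v -> dot (a *: u) v = a * dot u v;
  hilbert_dotC : forall u v, H u -> H v -> dot v u = Num.conj (dot u v);
  hilbert_nsq_ge0 : forall u, H u -> 0 <= nsq u;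
  hilbert_nsq_eq0 : forall u, H u -> nsq u = 0 -> u = 0;
  hilbert_complete : forall u : nat -> U, (forall n, H (u n)) ->
    (forall e : R, 0 < e -> exists N, forall m n, (N <= m)%N -> (N <= n)%N ->
      nsq (u m - u n) <= e) ->
    exists2 l, H l & forall e : R, 0 < e -> exists N, forall n, (N <= n)%N ->
      nsq (u n - l) <= e }.

Hypothesis hilH : is_hilbert.

Let H0 := hilbert0 hilH.
Let HD := hilbertD hilH.
Let HZ := hilbertZ hilH.
Let dotDl := hilbert_dotDl hilH.
Let dotZl := hilbert_dotZl hilH.
Let dotC := hilbert_dotC hilH.
Let nsq_ge0 := hilbert_nsq_ge0 hilH.

Lemma hilbertN u : H u -> H (- u).
Proof. by move=> Hu; rewrite -scaleN1r; exact: HZ. Qed.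

Lemma hilbertB u v : H u -> H v -> H (u - v).
Proof. by move=> Hu Hv; apply: HD => //; exact: hilbertN. Qed.

Lemma hilbert_dotNl u v : H u -> H v -> dot (- u) v = - dot u v.
Proof. by move=> Hu Hv; rewrite -scaleN1r dotZl// mulN1r. Qed.

Lemma hilbert_dotBl u v z : H u -> H v -> H z ->
  dot (u - v) z = dot u z - dot v z.
Proof.
by move=> Hu Hv Hz; rewrite dotDl ?hilbert_dotNl//; exact: hilbertN.
Qed.

Lemma hilbert_dotDr u v z : H u -> H v -> H z ->
  dot u (v + z) = dot u v + dot u z.
Proof.
move=> Hu Hv Hz; rewrite (dotC (HD Hv Hz) Hu) dotDl// rmorphD/=.
by rewrite -!dotC.
Qed.

Lemma hilbert_dotZr a u v : H u -> H v -> dot u (a *: v) = Num.conj a * dot u v.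
Proof.
by move=> Hu Hv; rewrite (dotC (HZ a Hv) Hu) dotZl// rmorphM/= -dotC.
Qed.

Lemma hilbert_dotNr u v : H u -> H v -> dot u (- v) = - dot u v.
Proof.
by move=> Hu Hv; rewrite (dotC (hilbertN Hv) Hu) hilbert_dotNl// rmorphN/=
  -dotC.
Qed.

Lemma hilbert_dotBr u v z : H u -> H v -> H z ->
  dot u (v - z) = dot u v - dot u z.
Proof.
by move=> Hu Hv Hz; rewrite hilbert_dotDr ?hilbert_dotNr//; exact: hilbertN.
Qed.

Lemma Re_dotC u v : H u -> H v -> complex.Re (dot v u) = complex.Re (dot u v).
Proof. by move=> Hu Hv; rewrite (dotC Hu Hv) ReJ. Qed.

Lemma nsqD u v : H u -> H v ->
  nsq (u + v) = nsq u + 2 * complex.Re (dot u v) + nsq v.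
Proof.
move=> Hu Hv; rewrite /nsq dotDl ?hilbert_dotDr//; try exact: HD.
by rewrite !ReD (Re_dotC Hu Hv); ring.
Qed.

Lemma nsqN u : H u -> nsq (- u) = nsq u.
Proof.
by move=> Hu; rewrite /nsq hilbert_dotNl ?hilbert_dotNr ?opprK//;
  exact: hilbertN.
Qed.

Lemma nsqB u v : H u -> H v ->
  nsq (u - v) = nsq u - 2 * complex.Re (dot u v) + nsq v.
Proof.
move=> Hu Hv; rewrite nsqD//; last exact: hilbertN.
by rewrite hilbert_dotNr// ReN nsqN//; ring.
Qed.

Lemma nsq_realZ (a : R) u : H u -> nsq (a%:C *: u) = a ^+ 2 * nsq u.
Proof.
move=> Hu; rewrite /nsq dotZl ?hilbert_dotZr//; last exact: HZ.
by rewrite conj_real !Re_realM; ring.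
Qed.

Lemma nsq_ZI u : H u -> nsq ('i%C *: u) = nsq u.
Proof.
move=> Hu; rewrite /nsq dotZl ?hilbert_dotZr//; last exact: HZ.
rewrite mulrA (_ : 'i%C * Num.conj 'i%C = 1) ?mul1r//.
by apply/eqP; rewrite eq_complex /=; apply/andP; split; apply/eqP; ring.
Qed.

Lemma hnorm_ge0 u : 0 <= hnorm dot u. Proof. exact: sqrtr_ge0. Qed.

Lemma sqr_hnorm u : H u -> hnorm dot u ^+ 2 = nsq u.
Proof. by move=> Hu; rewrite sqr_sqrtr//; exact: nsq_ge0. Qed.

Lemma hnorm_0 : hnorm dot 0 = 0.
Proof.
by rewrite /hnorm -[X in dot X](scale0r (0 : U)) dotZl// mul0r sqrtr0.
Qed.

Lemma hnorm_lt u (e : R) : 0 < e -> (hnorm dot u < e) = (nsq u < e ^+ 2).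
Proof.
by move=> e0; rewrite /hnorm -/(nsq u) -{1}(gtr0_norm e0) -sqrtr_sqr ltr_sqrt//
  exprn_gt0.
Qed.

Lemma Cauchy_Schwarz_Re u v : H u -> H v ->
  `|complex.Re (dot u v)| <= hnorm dot u * hnorm dot v.
Proof.
move=> Hu Hv; rewrite -(@ler_pXn2r _ 2)// ?nnegrE ?mulr_ge0 ?hnorm_ge0//.
rewrite exprMn !sqr_hnorm// real_normK ?num_real//.
set b := complex.Re _.
(* Positivity of [nsq (u + a v)] for real [a]; the inequality is this at the minimiser
   [a = - b / nsq v]. *)
have quad (a : R) : 0 <= nsq u + 2 * a * b + a ^+ 2 * nsq v.
  have Hav : H (a%:C *: v) by exact: HZ.
  have := nsq_ge0 (HD Hu Hav); rewrite nsqD// nsq_realZ//.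
  by rewrite hilbert_dotZr// conj_real Re_realM mulrA.
have [v0|v_neq0] := eqVneq (nsq v) 0.
  have v00 : v = 0 by exact: (hilbert_nsq_eq0 hilH).
  suff -> : b = 0 by rewrite v0 mulr0 expr0n.
  by rewrite /b v00 -(scale0r v) hilbert_dotZr// rmorph0 mul0r.
have v_gt0 : 0 < nsq v by rewrite lt_def v_neq0 nsq_ge0.
have := quad (- b / nsq v); rewrite -(pmulr_lge0 _ v_gt0).
suff -> : (nsq u + 2 * (- b / nsq v) * b + (- b / nsq v) ^+ 2 * nsq v) * nsq v =
  nsq u * nsq v - b ^+ 2 by rewrite subr_ge0.
by field.
Qed.

(** Multiplication by the imaginary unit keeps the norm and turns the imaginary part into a real
    part, up to sign. *)
Lemma Cauchy_Schwarz_Im u v : H u -> H v ->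
  `|complex.Im (dot u v)| <= hnorm dot u * hnorm dot v.
Proof.
move=> Hu Hv; have Hiu : H ('i%C *: u) by exact: HZ.
have := Cauchy_Schwarz_Re Hiu Hv.
rewrite dotZl// mulrC ReiNIm normrN.
by rewrite {1}/hnorm -/(nsq _) nsq_ZI.
Qed.

Lemma hnormD u v : H u -> H v ->
  hnorm dot (u + v) <= hnorm dot u + hnorm dot v.
Proof.
move=> Hu Hv; rewrite -(@ler_pXn2r _ 2)// ?nnegrE ?addr_ge0 ?hnorm_ge0//.
rewrite sqrrD !sqr_hnorm ?nsqD//; last exact: HD.
have := Cauchy_Schwarz_Re Hu Hv; rewrite ler_norml => /andP[_ ub].
rewrite lerD2r lerD2l mulr2n; lra.
Qed.

Lemma hnormN u : H u -> hnorm dot (- u) = hnorm dot u.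
Proof. by move=> Hu; rewrite /hnorm -!/(nsq _) nsqN. Qed.

Lemma hnormBC u v : H u -> H v -> hnorm dot (u - v) = hnorm dot (v - u).
Proof. by move=> Hu Hv; rewrite -opprB hnormN//; exact: hilbertB. Qed.

(** The single continuity argument about [dot]: the adjoint relation survives limits of the pair (a,
    b). It serves both for adjoints of closures and for closures of symmetric relations. *)
Lemma dot_eq_closed a b x y : H a -> H b -> H x -> H y ->
  (forall e : R, 0 < e -> exists a' b', [/\ H a', H b',
     hnorm dot (a - a') < e, hnorm dot (b - b') < e & dot b' x = dot a' y]) ->
  dot b x = dot a y.
Proof.
move=> Ha Hb Hx Hy near; apply/eqP; rewrite -subr_eq0; apply/eqP.
set z := _ - _; pose k := hnorm dot x + hnorm dot y + 1.
have k_gt0 : 0 < k by rewrite ltr_wpDl// addr_ge0// hnorm_ge0.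
have small (e : R) : 0 < e -> `|complex.Re z| <= e /\ `|complex.Im z| <= e.
  move=> e0; have ek : 0 < e / k by rewrite divr_gt0.
  have [a' [b' [Ha' Hb' la lb eqab]]] := near _ ek.
  have Haa : H (a - a') by exact: hilbertB.
  have Hbb : H (b - b') by exact: hilbertB.
  have -> : z = dot (b - b') x - dot (a - a') y.
    by rewrite !hilbert_dotBl// eqab opprB addrA subrK.
  have bound s t : `|s| <= hnorm dot (b - b') * hnorm dot x ->
      `|t| <= hnorm dot (a - a') * hnorm dot y -> `|s - t| <= e.
    move=> hs ht; apply: le_trans (ler_normB _ _) _.
    apply: le_trans (lerD hs ht) _.
    apply: (@le_trans _ _ (e / k * hnorm dot x + e / k * hnorm dot y)).
      by apply: lerD; apply: ler_wpM2r; rewrite ?hnorm_ge0// ltW.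
    have /(le_trans _) : e / k * k <= e by rewrite divfK// gt_eqF.
    by apply; rewrite -mulrDr ler_wpM2l ?(ltW ek)// /k lerDl.
  by split; rewrite ?ReD ?ImD ?ReN ?ImN; apply: bound;
    (exact: Cauchy_Schwarz_Re || exact: Cauchy_Schwarz_Im).
have eq0 (t : R) : (forall e, 0 < e -> `|t| <= e) -> t = 0.
  move=> h; apply/eqP; rewrite -normr_le0; apply/ler_addgt0Pl => e e0.
  by rewrite addr0 h.
apply/eqP; rewrite eq_complex.
by apply/andP; split; apply/eqP/eq0 => e /small[].
Qed.

(* Minimising sequences are Cauchy by the parallelogram law. *)
Lemma hilbert_projection (S : set U) h : S `<=` H -> S 0 ->
  (forall a u v, S u -> S v -> S (a *: u + v)) -> H h ->
  exists y, [/\ H y, forall e : R, 0 < e -> exists2 s, S s & hnorm dot (y - s)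
    < e
    & forall s, S s -> dot s (h - y) = 0].
Proof.
move=> SH S0 Slin Hh.
have SD u v : S u -> S v -> S (u + v).
  by move=> Su Sv; have := Slin 1 _ _ Su Sv; rewrite scale1r.
have SZ a u : S u -> S (a *: u).
  by move=> Su; have := Slin a _ _ Su S0; rewrite addr0.
pose E := [set nsq (h - s) | s in S].
have E_lb : lbound E 0 by move=> _ [s Ss <-]; apply: nsq_ge0;
  apply: hilbertB => //; exact: SH.
have E_inf : has_inf E by split; [exists (nsq (h - 0)); exists 0|exists 0].
pose d := inf E.
have d_le s : S s -> d <= nsq (h - s).
  by move=> Ss; apply: ge_inf; [exists 0|exists s].
have /choice [y yP] (n : nat) : exists s, S s /\ nsq (h - s) <= d + n.+1%:R^-1.
  have n0 : (0 : R) < n.+1%:R^-1 by rewrite invr_gt0 ltr0n.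
  by have [_ [s Ss <-] /ltW] := inf_adherent n0 E_inf; exists s.
have Sy n : S (y n) by case: (yP n).
have Hy n : H (y n) by exact: SH.
have Hhy n : H (h - y n) by exact: hilbertB.
have near0 (e : R) : 0 < e -> exists N, forall n, (N <= n)%N -> n.+1%:R^-1 <= e.
  move=> e0; have [N _ hN] := near_infty_natSinv_lt (PosNum e0).
  by exists N => n Nn; exact/ltW/hN.
have cauchy (e : R) : 0 < e -> exists N, forall m n, (N <= m)%N -> (N <= n)%N ->
    nsq (y m - y n) <= e.
  (* Two squared distances at most [d + e / 4] and a midpoint at squared distance at least [d]
     leave, by the parallelogram law, 4 (d + e / 4) - 4 d = e. *)
  move=> e0; have e4 : 0 < e / 4 by rewrite divr_gt0.
  have [N hN] := near0 _ e4; exists N => m n Nm Nn.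
  have Smid : S (2^-1%:C *: (y m + y n)) by apply: SZ; exact: SD.
  have mid : h - 2^-1%:C *: (y m + y n) =
      2^-1%:C *: ((h - y m) + (h - y n)).
    rewrite addrACA -opprD scalerBr -[h in h + h]scale1r -scalerDl scalerA.
    rewrite (_ : _ * (1 + 1) = 1) ?scale1r//.
    by apply/eqP; rewrite eq_complex /=; apply/andP; split; apply/eqP; field.
  have := d_le _ Smid; rewrite mid nsq_realZ; last exact: HD.
  have -> : y m - y n = (h - y n) - (h - y m) by rewrite opprB [RHS]addrC addrA
    subrK.
  rewrite (nsqD (Hhy m) (Hhy n)) (nsqB (Hhy n) (Hhy m)) (Re_dotC (Hhy m) (Hhy
    n)).
  have [_ ym] := yP m; have [_ yn] := yP n.
  have em := hN _ Nm; have en := hN _ Nn.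
  rewrite (_ : 2^-1 ^+ 2 = 4^-1); last by field.
  move: ym yn em en; set p := _^-1; set q := _^-1; set a := nsq _;
    set b := nsq _; set x := complex.Re _ => *; lra.
have [l Hl ly] := hilbert_complete hilH Hy cauchy.
have Hhl : H (h - l) by exact: hilbertB.
have ly_lt (e : R) : 0 < e -> exists N, forall n, (N <= n)%N -> hnorm dot (l -
  y n) < e.
  move=> e0; have e2 : 0 < e ^+ 2 / 2 by rewrite divr_gt0 ?exprn_gt0.
  have [N hN] := ly _ e2; exists N => n Nn.
  rewrite hnormBC// hnorm_lt// (le_lt_trans (hN _ Nn))//.
  by rewrite ltr_pdivrMr// ltr_pMr ?ltr1n// exprn_gt0.
exists l; split => //.
  by move=> e /ly_lt [N hN]; exists (y N) => //; exact: hN.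
have orth_near s n : S s ->
    complex.Re (dot s (h - y n)) ^+ 2 <= n.+1%:R^-1 * (nsq s + 1).
  move=> Ss; have Hs := SH _ Ss; set b := complex.Re _.
  (* Near-minimality of [y n] is tested against a move along [s]. The optimal step is [b / nsq s];
     adding 1 to the denominator keeps it nonzero and costs only a constant. *)
  pose t := b / (nsq s + 1); have Sts : S (y n + t%:C *: s) by apply: SD => //;
    exact: SZ.
  have := d_le _ Sts; have [_ yn] := yP n.
  rewrite opprD addrA nsqB//; last exact: HZ.
  rewrite nsq_realZ// hilbert_dotZr// conj_real Re_realM (Re_dotC _ (Hhy n))//
    -/b => lb.
  have s1 : 0 < nsq s + 1 by rewrite ltr_wpDl// nsq_ge0.
  have tb : t * (nsq s + 1) = b by rewrite /t divfK// gt_eqF.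
  have : 2 * t * b - t ^+ 2 * nsq s <= n.+1%:R^-1.
    by move: yn lb; set q := _^-1; set a := nsq _ => *; lra.
  rewrite -(ler_pM2r s1); apply: le_trans.
  have -> : (2 * t * b - t ^+ 2 * nsq s) * (nsq s + 1) = b ^+ 2 + t ^+ 2 * (nsq
    s + 1).
    by rewrite -tb; ring.
  by rewrite lerDl mulr_ge0 ?sqr_ge0// ltW.
have orth_Re s : S s -> complex.Re (dot s (h - l)) = 0.
  move=> Ss; have Hs := SH _ Ss.
  apply/eqP; rewrite -normr_le0; apply/ler_addgt0Pl => e e0; rewrite addr0.
  pose k := nsq s + 1; have k0 : 0 < k by rewrite ltr_wpDl// nsq_ge0.
  pose e2 := e / 2; have e20 : 0 < e2 by rewrite divr_gt0.
  have ek0 : 0 < e2 ^+ 2 / k by rewrite divr_gt0// exprn_gt0.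
  have [N1 h1] := near0 _ ek0.
  pose p := hnorm dot s + 1; have p0 : 0 < p by rewrite ltr_wpDl// hnorm_ge0.
  have ep0 : 0 < e2 / p by rewrite divr_gt0.
  have [N2 h2] := ly_lt _ ep0; pose n := maxn N1 N2.
  have -> : h - l = (h - y n) - (l - y n) by rewrite opprB addrA subrK.
  rewrite hilbert_dotBr//; last exact: hilbertB.
  rewrite ReD ReN; apply: le_trans (ler_normB _ _) _.
  rewrite (_ : e = e2 + e2); last by rewrite /e2; field.
  apply: lerD.
    rewrite -(@ler_pXn2r _ 2)// ?nnegrE ?(ltW e20)// real_normK ?num_real//.
    apply: le_trans (orth_near _ _ Ss) _.
    by rewrite -ler_pdivlMr// h1// leq_maxl.
  have Hly : H (l - y n) by exact: hilbertB.
  apply: le_trans (Cauchy_Schwarz_Re Hs Hly) _.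
  apply: (@le_trans _ _ (p * (e2 / p))); last by rewrite mulrC divfK// gt_eqF.
  apply: ler_pM; rewrite ?hnorm_ge0//; first by rewrite lerDl.
  by apply: ltW; apply: h2; rewrite leq_maxr.
move=> s Ss; have Hs := SH _ Ss; apply/eqP; rewrite eq_complex.
apply/andP; split; apply/eqP; first exact: orth_Re.
(* The imaginary part vanishes by the real case applied to [i s], which is again in [S]. *)
have := orth_Re _ (SZ 'i%C _ Ss).
by rewrite dotZl// mulrC ReiNIm => /eqP; rewrite oppr_eq0 => /eqP.
Qed.

End hilbert_spaces.

(** * A criterion for essential self-adjointness of positive operators *)

Section essential_selfadjointness.
Context {R : realType} {U : lmodType R[i]} (H : set U) (dot : U -> U -> R[i]).
Hypothesis hilH : is_hilbert H dot.

Lemma op_adjoint_closure (G : set (U * U)) : G `<=` H `*` H ->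
  op_adjoint H dot (op_closure H dot G) = op_adjoint H dot G.
Proof.
move=> GH; apply/seteqP; split=> p [Hp1 Hp2 padj]; split=> // q Gq.
  apply: padj; have [Hq1 Hq2] := GH _ Gq; split=> // e e0.
  by exists q; split=> //; rewrite subrr (hnorm_0 hilH).
have [Hq1 Hq2 qlim] := Gq.
apply: (dot_eq_closed hilH) => // e e0.
have [g [Gg d1 d2]] := qlim _ e0; have [Hg1 Hg2] := GH _ Gg.
by exists g.1, g.2; split => //; exact: padj.
Qed.

Lemma op_closure_sub_adjoint (G : set (U * U)) : G `<=` H `*` H ->
  (forall p q, G p -> G q -> dot q.2 p.1 = dot q.1 p.2) ->
  op_closure H dot G `<=` op_adjoint H dot G.
Proof.
move=> GH Gsym p [Hp1 Hp2 plim]; split=> // q Gq; have [Hq1 Hq2] := GH _ Gq.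
(* Conjugation moves [p], the pair known only as a limit, to the first slot, where [dot_eq_closed]
   takes limits. *)
rewrite (hilbert_dotC hilH Hp1 Hq2) (hilbert_dotC hilH Hp2 Hq1); congr Num.conj.
apply: esym; apply: (dot_eq_closed hilH) => // e e0.
have [g [Gg d1 d2]] := plim _ e0; have [Hg1 Hg2] := GH _ Gg.
by exists g.1, g.2; split => //; exact: Gsym.
Qed.

(* The range of [A + 1] is dense by the kernel hypothesis, and [A + 1] is
   bounded below by positivity. *)
Lemma positive_essentially_selfadjoint (D : set U) (A : U -> U) :
  dense_in H dot D ->
  D 0 -> (forall a u v, D u -> D v -> D (a *: u + v)) ->
  (forall u, D u -> H (A u)) ->
  (forall a u v, D u -> D v -> A (a *: u + v) = a *: A u + A v) ->
  (forall u v, D u -> D v -> dot (A u) v = dot u (A v)) ->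
  (forall u, D u -> 0 <= complex.Re (dot (A u) u)) ->
  (forall u, H u -> (forall v, D v -> dot (A v) u = - dot v u) -> u = 0) ->
  essentially_selfadjoint H dot (op_graph D A).
Proof.
move=> Ddense D0 Dlin HA Alin Asym Apos Aker.
have [DH _] := Ddense; pose G := op_graph D A.
have GH : G `<=` H `*` H by move=> _ [u Du <-]; split; [exact: DH|exact: HA].
have domG : op_dom G = D.
  by apply/seteqP; split=> [_ [_ [u Du <-] <-]//|u Du]; exists (u, A u) => //;
    exists u.
have Gcl : G `<=` op_closure H dot G.
  move=> q Gq; have [Hq1 Hq2] := GH _ Gq; split=> // e e0.
  by exists q; split=> //; rewrite subrr (hnorm_0 hilH).
have clG_adj : op_closure H dot G `<=` op_adjoint H dot G.
  by apply: op_closure_sub_adjoint => // _ _ [u Du <-] [v Dv <-]; exact: Asym.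
split; [exact: GH | by rewrite domG |split].
  split.
    by move=> _ [q [Hq1 Hq2 _] <-].
  move=> u Hu e e0; have [_ /(_ _ Hu _ e0)[v Dv uv]] := Ddense.
  by exists v => //; exists (v, A v) => //; apply: Gcl; exists v.
rewrite op_adjoint_closure//; apply/seteqP; split=> // -[u w] [/= Hu Hw uw].
have DB v v' : D v -> D v' -> D (v - v').
  by move=> Dv Dv'; rewrite addrC -scaleN1r; exact: Dlin.
have AB v v' : D v -> D v' -> A (v - v') = A v - A v'.
  by move=> Dv Dv'; rewrite addrC -scaleN1r Alin// scaleN1r addrC.
pose S := [set A v + v | v in D].
have A0 : A 0 = 0 by have := AB _ _ D0 D0; rewrite !subrr.
have SH : S `<=` H.
  by move=> _ [v Dv <-]; apply: (hilbertD hilH); [exact: HA|exact: DH].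
have S0 : S 0 by exists 0 => //; rewrite A0 addr0.
have Slin a s t : S s -> S t -> S (a *: s + t).
  move=> [v Dv <-] [v' Dv' <-]; exists (a *: v + v'); first exact: Dlin.
  by rewrite Alin// scalerDr addrACA.
have Huw : H (u + w) by exact: (hilbertD hilH).
have [y [Hy ylim yorth]] := hilbert_projection hilH SH S0 Slin Huw.
have Hz : H (u + w - y) by exact: (hilbertB hilH).
(* The residual of the projection is orthogonal to the range of [A + 1], so the kernel hypothesis
   kills it: [u + w] is a limit of elements of that range. *)
have yE : u + w = y.
  apply/eqP; rewrite -subr_eq0; apply/eqP/Aker => // v Dv.
  have /yorth : S (A v + v) by exists v.
  have Hv := DH _ Dv; have HAv := HA _ Dv.
  by rewrite (hilbert_dotDl hilH)// => /eqP; rewrite addr_eq0 => /eqP.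
rewrite -{}yE in ylim.
(* Expanding the square of [A v + v], the cross term is nonnegative by positivity. Hence convergence
   of [(A + 1) v_n] forces that of [v_n]. *)
have coercive v : D v -> nsq dot v <= nsq dot (A v + v).
  move=> Dv; have Hv := DH _ Dv; have HAv := HA _ Dv.
  rewrite (nsqD hilH HAv Hv) lerDr addr_ge0 ?(hilbert_nsq_ge0 hilH)//
    mulr_ge0//.
  exact: Apos.
have /choice [v vP] (n : nat) : exists v, D v /\ hnorm dot (u + w - (A v + v))
  < n.+1%:R^-1.
  have [|_ [v Dv <-] lt] := ylim n.+1%:R^-1; last by exists v.
  by rewrite invr_gt0 ltr0n.
have Dv n : D (v n) by case: (vP n).
have Hv n : H (v n) by exact: DH.
have HAv n : H (A (v n)) by exact: HA.
have HAvv n : H (A (v n) + v n) by exact: (hilbertD hilH).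
have Hres n : H (u + w - (A (v n) + v n)) by exact: (hilbertB hilH).
have res_lim (e : R) : 0 < e -> exists N, forall n, (N <= n)%N ->
    hnorm dot (u + w - (A (v n) + v n)) < e.
  move=> e0; have [N _ hN] := near_infty_natSinv_lt (PosNum e0).
  by exists N => n Nn; have [_ lt] := vP n; apply: (lt_trans lt); exact: hN.
have v_cauchy (e : R) : 0 < e -> exists N, forall m n, (N <= m)%N -> (N <= n)%N
  ->
    nsq dot (v m - v n) <= e.
  move=> e0; have e20 : 0 < Num.sqrt e / 2 by rewrite divr_gt0// sqrtr_gt0.
  have [N hN] := res_lim _ e20; exists N => m n Nm Nn.
  apply: le_trans (coercive _ (DB _ _ (Dv m) (Dv n))) _.
  rewrite AB// addrACA -opprD; apply: ltW.
  have -> : A (v m) + v m - (A (v n) + v n) =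
      (u + w - (A (v n) + v n)) - (u + w - (A (v m) + v m)).
    by rewrite [in RHS]opprB [RHS]addrC addrA subrK.
  rewrite -[ltRHS]sqr_sqrtr ?(ltW e0)// -hnorm_lt ?sqrtr_gt0//.
  apply: le_lt_trans (hnormD hilH _ _) _; rewrite ?(hnormN hilH)//.
    exact: (hilbertN hilH).
  by rewrite [ltRHS](splitr (Num.sqrt e)) ltrD ?hN.
have [l Hl vl] := hilbert_complete hilH Hv v_cauchy.
have Huwl : H (u + w - l) by exact: (hilbertB hilH).
have vl_lt (e : R) : 0 < e -> exists N, forall n, (N <= n)%N -> hnorm dot (l -
  v n) < e.
  move=> e0; have e2 : 0 < e ^+ 2 / 2 by rewrite divr_gt0 ?exprn_gt0.
  have [N hN] := vl _ e2; exists N => n Nn.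
  rewrite (hnormBC hilH)// hnorm_lt// (le_lt_trans (hN _ Nn))//.
  by rewrite ltr_pdivrMr// ltr_pMr ?ltr1n// exprn_gt0.
(* [A v_n] tends to [u + w - l], as the difference of the limits of [A v_n + v_n] and [v_n]. *)
have lcl : op_closure H dot G (l, u + w - l).
  split=> // e e0; have e20 : 0 < e / 2 by rewrite divr_gt0.
  have [N1 h1] := res_lim _ e20; have [N2 h2] := vl_lt _ e20.
  pose n := maxn N1 N2; exists (v n, A (v n)).
  have h1n := h1 n (leq_maxl _ _); have h2n := h2 n (leq_maxr _ _).
  have ee : e / 2 < e by rewrite ltr_pdivrMr// ltr_pMr// ltr1n.
  split; [by exists (v n)| exact: lt_trans h2n _ | rewrite /=].
  have -> : u + w - l - A (v n) = (u + w - (A (v n) + v n)) - (l - v n).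
    by rewrite opprB opprD !addrA subrK addrAC.
  have Hlv : H (l - v n) by exact: (hilbertB hilH).
  apply: le_lt_trans (hnormD hilH _ _) _; rewrite ?(hnormN hilH)//.
    exact: (hilbertN hilH).
  by rewrite [ltRHS](splitr e) ltrD.
suff ul : u = l by rewrite -ul addrAC subrr add0r in lcl.
(* The adjoint of [A] sends [u] to [w] and [l] to [u + w - l], hence [u - l] to [- (u - l)]. *)
apply/eqP; rewrite -subr_eq0; apply/eqP/Aker; first exact: (hilbertB hilH).
move=> q Dq; have Hq := DH _ Dq; have HAq := HA _ Dq.
have [_ _ ladj] := clG_adj _ lcl.
have Gq : G (q, A q) by exists q.
have /= := ladj _ Gq; have /= := uw _ Gq => e1 e2.
rewrite !(hilbert_dotBr hilH)// e1 e2.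
rewrite !(hilbert_dotBr hilH)// (hilbert_dotDr hilH)//.
by ring.
Qed.

End essential_selfadjointness.

(** * Unordered sums and weighted l2 spaces *)

Section complex_norm.
Context {R : realType}.
Implicit Types (x y : R[i]) (a : R).

Lemma normc_sqr x : Normc.normc x ^+ 2 = complex.Re x ^+ 2 + complex.Im x ^+ 2.
Proof. by case: x => a b /=; rewrite sqr_sqrtr// addr_ge0 ?sqr_ge0. Qed.

Lemma mul_conj x : x * Num.conj x = (Normc.normc x ^+ 2)%:C.
Proof. by rewrite -normCK rmorphXn. Qed.

Lemma normC_le_ReIm x : `|x| <= (`|complex.Re x| + `|complex.Im x|)%:C.
Proof.
rewrite normc_def lecR -(@ler_pXn2r _ 2)// ?nnegrE ?sqrtr_ge0 ?addr_ge0//.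
rewrite sqr_sqrtr ?addr_ge0 ?sqr_ge0// sqrrD !real_normK ?num_real//.
by rewrite addrAC lerDl mulrn_wge0// mulr_ge0.
Qed.

Lemma Re_le_normC x : (`|complex.Re x|)%:C <= `|x|.
Proof.
rewrite normc_def lecR -(@ler_pXn2r _ 2)// ?nnegrE ?sqrtr_ge0//.
by rewrite sqr_sqrtr ?addr_ge0 ?sqr_ge0// real_normK ?num_real// lerDl sqr_ge0.
Qed.

Lemma Re_sum {T : choiceType} (A : {fset T}) (z : T -> R[i]) :
  complex.Re (\sum_(t <- A) z t) = \sum_(t <- A) complex.Re (z t).
Proof. by elim/big_rec2: _ => // i u v _ <-; rewrite ReD. Qed.

Lemma Im_sum {T : choiceType} (A : {fset T}) (z : T -> R[i]) :
  complex.Im (\sum_(t <- A) z t) = \sum_(t <- A) complex.Im (z t).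
Proof. by elim/big_rec2: _ => // i u v _ <-; rewrite ImD. Qed.

Lemma Re_half x : complex.Re (2^-1 * x) = 2^-1 * complex.Re x.
Proof.
have -> : 2^-1 = (2^-1 : R)%:C :> R[i] by rewrite fmorphV rmorph_nat.
by case: x => p q /=; rewrite mul0r subr0.
Qed.

End complex_norm.

Section unordered_sums.
Context {R : realType} {T : choiceType}.
Implicit Types (A B : {fset T}).
Local Open Scope fset_scope.
Local Open Scope ring_scope.

#[local] Existing Instance summability.totally_filter.

Lemma big_fset_sub_split {W : zmodType} (F : T -> W) A B : A `<=` B ->
  \sum_(t <- B) F t = \sum_(t <- A) F t + \sum_(t <- B `\` A) F t.
Proof.
move=> /fsubsetP AB; rewrite (big_fsetID +%R (fun t => t \in A))/=;
  congr (_ + _).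
  by apply: eq_fbigl => t; rewrite !inE/=; apply: andb_idl; exact: AB.
by apply: eq_fbigl => t; rewrite !inE/= andbC.
Qed.

Definition psum_bounded (y : T -> R) (M : R) : Prop :=
  forall A, \sum_(t <- A) y t <= M.

(** Real counterpart of [has_sum]: sums are shown to exist here by suprema, and [has_sum_ReIm]
    carries this over to complex terms. *)
Definition has_rsum (y : T -> R) (l : R) : Prop := forall e : R, 0 < e ->
  exists A, forall B, A `<=` B -> `|\sum_(t <- B) y t - l| <= e.

Lemma ler_sum_fsetS (y : T -> R) A B : (forall t, 0 <= y t) -> A `<=` B ->
  \sum_(t <- A) y t <= \sum_(t <- B) y t.
Proof.
by move=> y0 /big_fset_sub_split ->; rewrite lerDl sumr_ge0.
Qed.

Lemma has_rsum_nonneg (y : T -> R) M : (forall t, 0 <= y t) ->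
  psum_bounded y M -> exists l, has_rsum y l.
Proof.
move=> y0 yM; pose E := [set \sum_(t <- A) y t | A in [set: {fset T}]].
have E_sup : has_sup E.
  by split; [exists (\sum_(t <- fset0) y t);
    exists fset0|exists M => _ [A _ <-]].
exists (sup E) => e e0; have [_ [A _ <-] ltA] := sup_adherent e0 E_sup.
exists A => B AB; rewrite distrC ger0_norm; last first.
  by rewrite subr_ge0; apply: sup_upper_bound => //; exists B.
rewrite lerBlDl -lerBlDr; apply: le_trans (ltW ltA) _.
exact: ler_sum_fsetS.
Qed.

Lemma has_rsumB (y z : T -> R) a b : has_rsum y a -> has_rsum z b ->
  has_rsum (fun t => y t - z t) (a - b).
Proof.
move=> ya zb e e0; have e20 : 0 < e / 2 by rewrite divr_gt0.
have [A hA] := ya _ e20; have [B hB] := zb _ e20.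
exists (A `|` B) => C; rewrite fsubUset => /andP[AC BC].
rewrite big_split/= sumrN.
have -> (p q : R) : p - q - (a - b) = (p - a) - (q - b) by ring.
apply: le_trans (ler_normB _ _) _.
by rewrite [leRHS](splitr e) lerD ?hA ?hB.
Qed.

(** [z] is the difference of the nonnegative families [z + y] and [y], both with bounded partial
    sums. *)
Lemma has_rsum_dominated (y z : T -> R) M : (forall t, `|z t| <= y t) ->
  psum_bounded y M -> exists l, has_rsum z l.
Proof.
move=> zy yM; have y0 t : 0 <= y t by exact: le_trans (zy t).
have yz0 t : 0 <= z t + y t.
  by have := zy t; rewrite ler_norml => /andP[];
    rewrite lerNl -subr_ge0 opprK addrC.
have yzM : psum_bounded (fun t => z t + y t) (M + M).
  move=> A; rewrite big_split/= lerD//; apply: le_trans (yM A).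
  by apply: ler_sum => t _; exact: le_trans (ler_norm _) (zy t).
have [a ya] := has_rsum_nonneg y0 yM; have [b yb] := has_rsum_nonneg yz0 yzM.
exists (b - a) => e e0; have [A hA] := has_rsumB yb ya e0.
by exists A => B /hA; under eq_bigr do rewrite addrK.
Qed.

Definition has_sum (x : T -> R[i]) (l : R[i]) : Prop :=
  summability.partial_sum x @ summability.totally --> (l : R[i]^o).

Lemma partial_sumE (x : T -> R[i]) A :
  summability.partial_sum x A = \sum_(t <- A) x t.
Proof. by rewrite /summability.partial_sum [RHS]big_seq_fsetE. Qed.

Let FF : Filter (@summability.totally T).
Proof. by typeclasses eauto. Qed.

Lemma has_sumP (x : T -> R[i]) l : has_sum x l <->
  forall e : R[i], 0 < e ->
    exists A, forall B, A `<=` B -> `|l - \sum_(t <- B) x t| <= e.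
Proof.
split=> [/(@cvgrPdist_le _ (R[i]^o) _ _ FF (summability.partial_sum x)) xl e
  /xl|xl].
  by move=> [A _ hA]; exists A => B /hA /=; rewrite partial_sumE.
apply/(@cvgrPdist_le _ (R[i]^o) _ _ FF (summability.partial_sum x)) => e /xl [A
  hA].
by exists A => // B /hA /=; rewrite partial_sumE.
Qed.

Lemma has_sum_ReIm (x : T -> R[i]) a b :
  has_rsum (fun t => complex.Re (x t)) a ->
  has_rsum (fun t => complex.Im (x t)) b -> has_sum x (a +i* b).
Proof.
(* A positive element of [R[i]] has zero imaginary part, so the tolerance is real. *)
move=> xa xb; apply/has_sumP => -[e e']; rewrite ltcE/= => /andP[/eqP -> e0].
have e20 : 0 < e / 2 by rewrite divr_gt0.
have [A hA] := xa _ e20; have [B hB] := xb _ e20.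
exists (A `|` B) => C; rewrite fsubUset => /andP[AC BC].
apply: le_trans (normC_le_ReIm _) _.
rewrite complexr0 lecR ReD ImD ReN ImN [leRHS](splitr e) distrC [X in _ +
  X]distrC.
by rewrite Re_sum Im_sum lerD ?hA ?hB.
Qed.

Lemma has_sum_Re (x : T -> R[i]) l : has_sum x l ->
  has_rsum (fun t => complex.Re (x t)) (complex.Re l).
Proof.
move=> /has_sumP xl e e0; have e0' : 0 < e%:C by rewrite ltcR.
have [A hA] := xl _ e0'; exists A => B /hA hB.
rewrite -lecR; apply: le_trans hB; rewrite distrC.
by apply: le_trans (Re_le_normC _); rewrite ReD ReN Re_sum.
Qed.

Lemma has_sum_sum (x : T -> R[i]) l : has_sum x l ->
  summability.sum (x : T -> R[i]^o) = l.
Proof. by move=> xl; apply: cvg_lim => //; exact: norm_hausdorff. Qed.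

Lemma has_sum_dominated (x : T -> R[i]) (y : T -> R) M :
  (forall t, `|complex.Re (x t)| <= y t) -> (forall t, `|complex.Im (x t)| <= y
    t) ->
  psum_bounded y M -> has_sum x (summability.sum (x : T -> R[i]^o)).
Proof.
move=> xr xi yM; have [a xa] := has_rsum_dominated xr yM.
have [b xb] := has_rsum_dominated xi yM.
by have s := has_sum_ReIm xa xb; rewrite (has_sum_sum s).
Qed.

Lemma has_sumD (x y : T -> R[i]) a b : has_sum x a -> has_sum y b ->
  has_sum (fun t => x t + y t) (a + b).
Proof.
move=> xa xb; rewrite /has_sum.
rewrite (_ : summability.partial_sum _ =
  (fun A => (summability.partial_sum x A : R[i]^o) + summability.partial_sum y
    A)).
  exact: (@cvgD _ (R[i]^o) _ _ FF _ _ _ _ xa xb).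
by apply/funext => A; rewrite !partial_sumE big_split.
Qed.

Lemma has_sumZ (x : T -> R[i]) k a : has_sum x a ->
  has_sum (fun t => k * x t) (k * a).
Proof.
move=> xa; rewrite /has_sum.
rewrite (_ : summability.partial_sum _ =
  (fun A => k *: (summability.partial_sum x A : R[i]^o))).
  exact: (@cvgZl_tmp _ (R[i]^o) _ _ FF _ _ _ xa).
by apply/funext => A; rewrite !partial_sumE -mulr_sumr.
Qed.

Lemma has_sum_conj (x : T -> R[i]) a : has_sum x a ->
  has_sum (fun t => Num.conj (x t)) (Num.conj a).
Proof.
move=> /has_sumP xa; apply/has_sumP => e /xa[A hA]; exists A => B /hA.
by rewrite -rmorph_sum -rmorphB norm_conjC.
Qed.

Lemma has_sum_finite (x : T -> R[i]) A : (forall t, t \notin A -> x t = 0) ->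
  has_sum x (\sum_(t <- A) x t).
Proof.
move=> x0; apply/has_sumP => e e0; exists A => B AB.
rewrite (big_fset_sub_split _ AB).
have -> : \sum_(t <- B `\` A) x t = 0.
  by rewrite big_seq big1// => t; rewrite inE => /andP[/x0].
by rewrite addr0 subrr normr0 ltW.
Qed.

(** Dominated convergence for series: outside a finite set the tail of [y] is small, and on that set
    the finitely many factors [m n t] all vanish once [n] is large. *)
Lemma dominated_tail (y : T -> R) (m : nat -> T -> R) M C :
  (forall t, 0 <= y t) -> psum_bounded y M ->
  (forall n t, 0 <= m n t <= C) ->
  (forall t, exists N, forall n, (N <= n)%N -> m n t = 0) ->
  forall e : R, 0 < e -> exists N, forall n, (N <= n)%N ->
    psum_bounded (fun t => m n t * y t) e.
Proof.
move=> y0 yM mC m0 e e0; have [l hl] := has_rsum_nonneg y0 yM.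
pose k := `|C| + 1; have k0 : 0 < k by rewrite ltr_wpDl.
(* Sums over [A] and over a larger set each differ from [l] by at most [e / k / 2], so the sum of
   [y] over the difference is at most [e / k]; the factor [m] costs at most [k]. *)
have ek0 : 0 < e / k / 2 by rewrite !divr_gt0.
have [A hA] := hl _ ek0; have /choice [N hN] := m0.
exists (\max_(t <- A) N t)%N => n Nn B.
have my0 t : 0 <= m n t * y t by rewrite mulr_ge0//; case/andP: (mC n t).
apply: (@le_trans _ _ (\sum_(t <- A `|` B) m n t * y t)).
  by apply: ler_sum_fsetS => //; rewrite fsubsetUr.
have AAB : A `<=` A `|` B by rewrite fsubsetUl.
rewrite (big_fset_sub_split _ AAB) big_seq big1 ?add0r; last first.
  by move=> t tA; rewrite hN ?mul0r//; apply: leq_trans Nn;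
    exact: leq_bigmax_seq.
apply: (@le_trans _ _ (\sum_(t <- (A `|` B) `\` A) k * y t)).
  apply: ler_sum => t _; apply: ler_wpM2r => //; case/andP: (mC n t) => _ h.
  by apply: le_trans h _; rewrite /k (le_trans (ler_norm _))// lerDl.
have h1 := hA _ AAB; have h2 := hA _ (fsubset_refl A).
move: h1; rewrite (big_fset_sub_split _ AAB) -mulr_sumr.
move: h2; set p := \sum_(_ <- A) _; set q := \sum_(_ <- _) _.
rewrite !ler_norml => /andP[a1 a2] /andP[b1 b2].
rewrite mulrC -ler_pdivlMr//; move: a1 b2; set u := e / k => *; lra.
Qed.

End unordered_sums.

Lemma real_Cauchy_complete {R : realType} (s : nat -> R) :
  (forall e : R, 0 < e -> exists N, forall m n, (N <= m)%N -> (N <= n)%N ->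
    `|s m - s n| <= e) ->
  exists l : R, s n @[n --> \oo] --> l.
Proof.
move=> cs; apply/cvg_ex/cauchy_cvgP/cauchy_exP => e e0.
have [|N hN] := cs (e / 2); first by rewrite divr_gt0.
exists (s N), N => // n Nn; rewrite /ball/=.
by apply: le_lt_trans (hN _ _ (leqnn _) Nn) _;
  rewrite ltr_pdivrMr// ltr_pMr ?ltr1n.
Qed.

(** * Weighted l2 spaces are Hilbert spaces *)

Section l2_hilbert.
Context {R : realType} {T : choiceType} (w : T -> R).
Hypothesis w_gt0 : forall t, 0 < w t.
Implicit Types (f g : T -> R[i]^o) (A : {fset T}).

Definition wsq (f : T -> R[i]) (t : T) : R := w t * Normc.normc (f t) ^+ 2.

Lemma wsq_ge0 f t : 0 <= wsq f t.
Proof. by rewrite mulr_ge0 ?sqr_ge0// ltW. Qed.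

(** Trades the extended-real sum for bounded finite partial sums, the form in which membership is
    used from here on. *)
Lemma l2P f : l2 w f <-> exists M, psum_bounded (wsq f) M.
Proof.
split=> [fl2|[M fM]].
  pose E := (\esum_(t in [set: T]) (wsq f t)%:E)%E.
  have E_fin : E \is a fin_num.
    by rewrite ge0_fin_numE//; apply: esum_ge0 => t _; rewrite lee_fin wsq_ge0.
  exists (fine E) => A; rewrite -lee_fin fineK// -sumEFin.
  apply: esum_ge; exists [set` A] => //.
  by rewrite -fsbig_seq.
apply: (@le_lt_trans _ _ M%:E); last exact: ltry.
apply: ge_ereal_sup => _ [X [finX _] <-].
by rewrite fsbig_finite//= sumEFin lee_fin; exact: fM.
Qed.

Definition l2_term f g (t : T) : R[i] := (w t)%:C * f t * Num.conj (g t).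

Lemma l2_term_bound f g t :
  `|complex.Re (l2_term f g t)| <= wsq f t + wsq g t /\
  `|complex.Im (l2_term f g t)| <= wsq f t + wsq g t.
Proof.
rewrite /l2_term -mulrA /wsq !normc_sqr -mulrDr.
case: (f t) (g t) => [a b] [c d] /=; have w0 := w_gt0 t.
rewrite !mul0r subr0 addr0 !normrM gtr0_norm//.
have ineq (p q r s : R) : `|p * q + r * s| <= p ^+ 2 + r ^+ 2 + (q ^+ 2 + s ^+
  2).
  rewrite ler_norml; apply/andP; split; rewrite -subr_ge0.
    rewrite (_ : _ - _ = 2^-1 * ((p + q) ^+ 2 + (r + s) ^+ 2 + p ^+ 2 + q ^+ 2
      + r ^+ 2 + s ^+ 2)).
      by rewrite mulr_ge0 ?invr_ge0// !addr_ge0 ?sqr_ge0.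
    by field.
  rewrite (_ : _ - _ = 2^-1 * ((p - q) ^+ 2 + (r - s) ^+ 2 + p ^+ 2 + q ^+ 2 +
    r ^+ 2 + s ^+ 2)).
    by rewrite mulr_ge0 ?invr_ge0// !addr_ge0 ?sqr_ge0.
  by field.
rewrite !ler_pM2l//; split.
  by apply: le_trans (ineq a c b d); rewrite le_eqVlt; apply/orP; left;
    apply/eqP; congr (`|_|); ring.
apply: le_trans (ineq a (- d) b c) _;
  last by rewrite sqrrN [X in _ + X <= _]addrC.
Qed.

Lemma has_sum_l2dot f g : l2 w f -> l2 w g ->
  has_sum (l2_term f g) (l2dot w f g).
Proof.
move=> /l2P[M fM] /l2P[N gN].
apply: (@has_sum_dominated _ _ _ (fun t => wsq f t + wsq g t) (M + N)).
- by move=> t; case: (l2_term_bound f g t).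
- by move=> t; case: (l2_term_bound f g t).
- by move=> A; rewrite big_split lerD.
Qed.

Lemma l2dot_finite f g A : (forall t, t \notin A -> f t = 0) ->
  l2dot w f g = \sum_(t <- A) (w t)%:C * f t * Num.conj (g t).
Proof.
move=> f0; apply: has_sum_sum; apply: has_sum_finite => t /f0 ->.
by rewrite mulr0 mul0r.
Qed.

Lemma l2D f g : l2 w f -> l2 w g -> l2 w (f + g).
Proof.
move=> /l2P[M fM] /l2P[N gN]; apply/l2P; exists (2 * (M + N)) => A.
apply: (@le_trans _ _ (\sum_(t <- A) 2 * (wsq f t + wsq g t))).
  apply: ler_sum => t _; rewrite /wsq -mulrDr [leRHS]mulrCA ler_pM2l//.
  rewrite !normc_sqr ReD ImD /=; case: (f t) (g t) => [a b] [c d] /=.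
  rewrite -subr_ge0 (_ : _ - _ = (a - c) ^+ 2 + (b - d) ^+ 2); last by ring.
  by rewrite addr_ge0 ?sqr_ge0.
by rewrite -mulr_sumr ler_pM2l// big_split lerD.
Qed.

Lemma wsqZ (a : R[i]) f t : wsq (a *: f) t = Normc.normc a ^+ 2 * wsq f t.
Proof.
by rewrite /wsq (_ : (a *: f) t = a * f t)// Normc.normcM exprMn mulrCA.
Qed.

Lemma l2Z (a : R[i]) f : l2 w f -> l2 w (a *: f).
Proof.
move=> /l2P[M fM]; apply/l2P; exists (Normc.normc a ^+ 2 * M) => A.
under eq_bigr do rewrite wsqZ.
by rewrite -mulr_sumr ler_wpM2l ?sqr_ge0.
Qed.

Lemma l2_term_diag f t : complex.Re (l2_term f f t) = wsq f t.
Proof. by rewrite /l2_term -mulrA mul_conj -rmorphM. Qed.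

(** With [nsq_le], this identifies the squared norm, defined as the limit of a net, with the
    supremum of the partial sums. *)
Lemma psum_le_nsq f A : l2 w f -> \sum_(t <- A) wsq f t <= nsq (l2dot w) f.
Proof.
move=> fl2; apply/ler_addgt0Pl => e e0.
have [B hB] := has_sum_Re (has_sum_l2dot fl2 fl2) e0.
apply: le_trans (ler_sum_fsetS (wsq_ge0 f) (fsubsetUl A B)) _.
have := hB _ (fsubsetUr A B); under eq_bigr do rewrite l2_term_diag.
by rewrite ler_norml => /andP[_]; rewrite lerBlDr.
Qed.

Lemma wsq_le_nsq f t : l2 w f -> wsq f t <= nsq (l2dot w) f.
Proof. by move=> /(psum_le_nsq [fset t]%fset); rewrite big_seq_fset1. Qed.

Lemma nsq_le f M : l2 w f -> psum_bounded (wsq f) M -> nsq (l2dot w) f <= M.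
Proof.
move=> fl2 fM; apply/ler_addgt0Pl => e e0.
have [B hB] := has_sum_Re (has_sum_l2dot fl2 fl2) e0.
have := hB _ (fsubset_refl B); under eq_bigr do rewrite l2_term_diag.
rewrite ler_norml => /andP[+ _]; rewrite lerBrDl lerBlDr => /le_trans; apply.
by rewrite addrC lerD2l.
Qed.

Lemma l2_complete (u : nat -> T -> R[i]^o) : (forall n, l2 w (u n)) ->
  (forall e : R, 0 < e -> exists N, forall m n, (N <= m)%N -> (N <= n)%N ->
    nsq (l2dot w) (u m - u n) <= e) ->
  exists2 l : T -> R[i]^o, l2 w l & forall e : R, 0 < e ->
    exists N, forall n, (N <= n)%N -> nsq (l2dot w) (u n - l) <= e.
Proof.
move=> ul2 cu.
have l2N f : l2 w f -> l2 w (- f) by rewrite -scaleN1r; exact: l2Z.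
have l2B f g : l2 w f -> l2 w g -> l2 w (f - g).
  by move=> fl gl; apply: l2D => //; exact: l2N.
(* As [w t] is positive, the norm controls the value at [t], so both coordinates of [u n t] are
   Cauchy. *)
have ptwise t (e : R) : 0 < e -> exists N, forall m n, (N <= m)%N -> (N <= n)%N
  ->
    `|complex.Re (u m t) - complex.Re (u n t)| <= e /\
    `|complex.Im (u m t) - complex.Im (u n t)| <= e.
  move=> e0; have ew0 : 0 < w t * e ^+ 2 by rewrite mulr_gt0// exprn_gt0.
  have [N hN] := cu _ ew0; exists N => m n Nm Nn.
  have := le_trans (wsq_le_nsq t (l2B _ _ (ul2 m) (ul2 n))) (hN _ _ Nm Nn).
  rewrite /wsq ler_pM2l// normc_sqr ReD ImD ReN ImN.
  rewrite -!(real_normK (num_real (_ - _))) => le_e.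
  by split; rewrite -(@ler_pXn2r _ 2)// ?nnegrE ?(ltW e0)//;
    apply: le_trans le_e; rewrite ?lerDl ?lerDr sqr_ge0.
have /choice [a ha] t := real_Cauchy_complete (fun e e0 =>
  let: ex_intro N hN := ptwise t e e0 in
  ex_intro _ N (fun m n Nm Nn => (hN m n Nm Nn).1)).
have /choice [b hb] t := real_Cauchy_complete (fun e e0 =>
  let: ex_intro N hN := ptwise t e e0 in
  ex_intro _ N (fun m n Nm Nn => (hN m n Nm Nn).2)).
pose l : T -> R[i]^o := fun t => a t +i* b t.
(* Fatou's argument: a finite partial sum for [u n - l] is the limit over [m] of those for
   [u n - u m], which are eventually at most [e]. *)
have lim_bound n (e : R) : (exists N, forall m, (N <= m)%N -> nsq (l2dot w) (u
  n - u m) <= e) ->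
    psum_bounded (wsq (u n - l)) e.
  move=> [N hN] A; pose S m := \sum_(t <- A) wsq (u n - u m) t.
  have cvgS : S m @[m --> \oo] --> \sum_(t <- A) wsq (u n - l) t.
    apply: cvg_big => [|t _]; first exact: add_continuous.
    rewrite /wsq normc_sqr ReD ImD ReN ImN.
    under eq_fun do rewrite normc_sqr ReD ImD ReN ImN.
    apply: cvgMl_tmp; apply: cvgD; rewrite !expr2; apply: cvgM; (apply: cvgB;
      first exact: cvg_cst); [exact: ha|exact: ha|exact: hb|exact: hb].
  rewrite -(cvg_lim (@Rhausdorff R) cvgS); apply: limr_le;
    first exact: cvgP cvgS.
  exists N => // m /hN; apply: le_trans;
    exact: psum_le_nsq (l2B _ _ (ul2 n) (ul2 m)).
have lim (e : R) : 0 < e -> exists N, forall n, (N <= n)%N -> psum_bounded (wsq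
  (u n - l)) e.
  by move=> /cu[N hN]; exists N => n Nn; apply: lim_bound; exists N => m;
    exact: hN.
have l_l2 : l2 w l.
  have [N hN] := lim _ ltr01.
  rewrite (_ : l = u N - (u N - l)); last by rewrite opprB addrCA subrr addr0.
  by apply: l2B => //; apply/l2P; exists 1; exact: hN.
exists l => // e /lim[N hN]; exists N => n /hN;
  exact: nsq_le (l2B _ _ (ul2 n) l_l2).
Qed.

Lemma l2_is_hilbert : is_hilbert (U := T -> R[i]^o) (l2 w) (l2dot w).
Proof.
split.
- by apply/l2P; exists 0 => A; rewrite big1// => t _;
  rewrite /wsq Normc.normc0 expr0n mulr0.
- exact: l2D.
- exact: l2Z.
- move=> f g h fl gl hl; apply: has_sum_sum.
  have := has_sumD (has_sum_l2dot fl hl) (has_sum_l2dot gl hl).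
  by congr has_sum; apply/funext => t; rewrite /l2_term /= mulrDr mulrDl.
- move=> a f g fl gl; apply: has_sum_sum.
  have := has_sumZ (k := a) (has_sum_l2dot fl gl).
  by congr has_sum; apply/funext => t; rewrite /l2_term /= !mulrA [a * _]mulrC.
- move=> f g fl gl; apply: has_sum_sum.
  have := has_sum_conj (has_sum_l2dot fl gl).
  congr has_sum; apply/funext => t;
    rewrite /l2_term !rmorphM/= conj_real conjCK.
  by rewrite mulrAC.
- by move=> f fl; have := psum_le_nsq fset0 fl; rewrite big_seq_fset0.
- move=> f fl f0; apply/funext => t; have := wsq_le_nsq t fl.
  rewrite f0 => le0; have /eqP : wsq f t == 0 by rewrite eq_le le0 wsq_ge0.
  move=> /eqP; rewrite mulf_eq0 (gt_eqF (w_gt0 t)) /= sqrf_eq0 => /eqP.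
  exact: Normc.eq0_normc.
- exact: l2_complete.
Qed.

End l2_hilbert.

(** * Green's formula and the space of cochains *)

Section graph_sums.
Context {R : realType} {V : choiceType} (K : graph V).
Hypothesis K_locally_finite : locally_finite K.
Implicit Types (W : {fset V}) (e : edge K).

Definition heads (x : V) : set (edge K) := [set e : edge K | ehead e = x].

Lemma ehead_opp e : ehead (eopp e) = etail e. Proof. by []. Qed.

Lemma etail_opp e : etail (eopp e) = ehead e. Proof. by []. Qed.

Lemma eoppK : involutive (@eopp V K).
Proof. by move=> e; apply/val_inj; rewrite /= [RHS]surjective_pairing. Qed.

Lemma eopp_bij : bijective (@eopp V K).
Proof. by exists (@eopp V K); exact: eoppK. Qed.

Lemma finite_edges_meeting (A : set V) : finite_set A ->
  finite_set [set e : edge K | A (ehead e) \/ A (etail e)].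
Proof.
move=> finA; apply: (@sub_finite_set _ _ (\bigcup_(x in A) edges_at K x)).
  by move=> e [Ae|Ae]; [exists (ehead e) => //; left|exists (etail e) => //;
    right].
by apply: bigcup_finite => // x _; exact: K_locally_finite.
Qed.

Lemma finite_heads x : finite_set (heads x).
Proof.
by apply: sub_finite_set (K_locally_finite x) => e ex; left.
Qed.

Definition edges_into W : {fset edge K} := fset_set [set e : edge K | ehead e
  \in W].

Lemma in_edges_into W e : (e \in edges_into W) = (ehead e \in W).
Proof.
rewrite in_fset_set; last first.
  apply: sub_finite_set (finite_edges_meeting (finite_fset W)) => f /= fW.
  by left.
by apply/idP/idP; rewrite inE.
Qed.

(** The sets [heads x] partition the oriented edges, so each edge into [W] is counted exactly
    once. *)
Lemma sum_heads {U : zmodType} W (G : edge K -> U) :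
  \sum_(x <- W) \sum_(e \in heads x) G e = \sum_(e <- edges_into W) G e.
Proof.
transitivity (\sum_(x <- W) \sum_(e <- edges_into W | ehead e == x) G e).
  apply: eq_big_seq => x xW; rewrite [RHS]bigfs//.
    by apply: eq_fsbigl; apply/seteqP; split => e /eqP.
  by move=> e /eqP ex; rewrite in_edges_into ex xW.
rewrite (exchange_big_dep xpredT)//=; apply: eq_big_seq => e.
rewrite in_edges_into => eW.
rewrite (big_rem _ eW)/= eqxx big_seq_cond big1 ?addr0// => x /andP[xW /eqP ex].
by move: xW; rewrite -ex mem_rem_uniqF.
Qed.

Lemma fsum_heads {U : zmodType} (G : edge K -> U) : finitely_supported G ->
  \sum_(x \in [set: V]) \sum_(e \in heads x) G e = \sum_(e \in [set: edge K]) G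
    e.
Proof.
move=> finG; pose W := [fset ehead e | e in fset_set [set e : edge K | G e !=
  0]]%fset.
have G0 e : ehead e \notin W -> G e = 0.
  apply: contraNeq => Ge; apply/imfsetP; exists e => //=.
  by rewrite in_fset_set// inE.
rewrite (fsbigTE W) ?(fsbigTE (edges_into W)); first exact: sum_heads.
  by move=> e; rewrite in_edges_into => /G0.
by move=> x xW; apply: fsbig1 => e ex; apply: G0; rewrite ex.
Qed.

Lemma fsum_eopp {U : zmodType} (G : edge K -> U) :
  \sum_(e \in [set: edge K]) G (eopp e) = \sum_(e \in [set: edge K]) G e.
Proof. by rewrite [RHS](reindex_fsbigT (@eopp V K) G eopp_bij). Qed.

Lemma finitely_supported_eopp {U : zmodType} (G : edge K -> U) :
  finitely_supported G -> finitely_supported (G \o @eopp V K).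
Proof.
move=> finG; apply: sub_finite_set (finite_image (@eopp V K) finG).
by move=> e /= Ge; exists (eopp e) => //; exact: eoppK.
Qed.

End graph_sums.

Arguments heads {V} K x.

Lemma finitely_supported_sub {T : Type} {U W : zmodType} (f : T -> U) (g : T ->
  W) :
  finitely_supported f -> (forall t, f t = 0 -> g t = 0) -> finitely_supported
    g.
Proof.
move=> finf fg; apply: sub_finite_set finf => t /=.
by apply: contra_neq; exact: fg.
Qed.

Lemma finitely_supported_outside {T : choiceType} {U : zmodType} (f : T -> U) t
  :
  finitely_supported f -> t \notin fset_set [set t | f t != 0] -> f t = 0.
Proof.
by move=> finf; apply: contraNeq => ft; rewrite in_fset_set// inE.
Qed.

Lemma fsum_split {T : choiceType} {U : zmodType} (f g : T -> U) :
  finitely_supported f -> finitely_supported g ->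
  \sum_(t \in [set: T]) (f t + g t) =
  \sum_(t \in [set: T]) f t + \sum_(t \in [set: T]) g t.
Proof.
move=> finf fing.
pose A := (fset_set [set t | f t != 0] `|` fset_set [set t | g t != 0])%fset.
have [f0 g0] : (forall t, t \notin A -> f t = 0) /\ (forall t, t \notin A -> g
  t = 0).
  by split=> t; rewrite in_fsetU negb_or => /andP[? ?];
    exact: finitely_supported_outside.
rewrite !(fsbigTE A)//; first by rewrite big_split.
by move=> t tA; rewrite f0 ?g0 ?addr0.
Qed.

(** Finite support is asked of the product of [f] and [g], so that either of them may supply it. *)
Lemma l2dot_fsum {R : realType} {T : choiceType} (w : T -> R) (f g : T -> R[i])
  :
  finitely_supported (l2_term w f g) ->
  l2dot w f g = \sum_(t \in [set: T]) l2_term w f g t.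
Proof.
move=> finfg.
rewrite (fsbigTE (fset_set [set t | l2_term w f g t != 0])).
  by apply: has_sum_sum; apply: has_sum_finite => t;
    exact: finitely_supported_outside.
by move=> t; exact: finitely_supported_outside.
Qed.

Section green.
Context {R : realType} {V : choiceType} (K : graph V).
Context (c : V -> R) (r : edge K -> R).
Hypotheses (c_gt0 : forall v, 0 < c v) (r_gt0 : forall e, 0 < r e).
Hypothesis r_sym : forall e, r (eopp e) = r e.
Hypothesis K_locally_finite : locally_finite K.
Implicit Types (f : V -> R[i]) (phi : edge K -> R[i]).

Lemma C1_coboundary f : C1 (coboundary (K := K) f).
Proof. by move=> e; rewrite /coboundary ehead_opp etail_opp opprB. Qed.

Lemma finitely_supported_coboundary {U : zmodType} (f : V -> U) :
  finitely_supported f -> finitely_supported (coboundary (K := K) f).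
Proof.
move=> finf; apply: sub_finite_set (finite_edges_meeting K_locally_finite finf).
move=> e /=; rewrite /coboundary => fe;
  apply: contrapT => /not_orP[/negP/negPn/eqP f1 /negP/negPn/eqP f2].
by move: fe; rewrite f1 f2 subrr eqxx.
Qed.

Lemma finitely_supported_delta phi :
  finitely_supported phi -> finitely_supported (delta c r phi).
Proof.
move=> finphi; apply: sub_finite_set (finite_image (@ehead V K) finphi).
move=> x /= dx; apply: contrapT => nx; move/eqP: dx; apply.
rewrite /delta fsbig1 ?mulr0// => e ex; apply/eqP; rewrite mulf_eq0; apply/orP;
  right.
by apply: contraPT nx => phie; apply; exists e.
Qed.

(** Pairing [e] with [eopp e]: [r] is even and [psi] odd, so the two terms at the heads combine to
    [h (ehead e) - h (etail e)], and each pair is met twice. The support condition is on a product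
    because it comes from [psi] in [green_delta] and from [h] in [green_coboundary]. *)
Lemma sum_by_parts (psi : edge K -> R[i]) (h : V -> R[i]) : C1 psi ->
  finitely_supported (fun e => (r e)%:C * psi e * h (ehead e)) ->
  \sum_(x \in [set: V]) (\sum_(e \in heads K x) (r e)%:C * psi e) * h x =
  2^-1 * \sum_(e \in [set: edge K]) (r e)%:C * psi e * coboundary h e.
Proof.
move=> psiC1; set F := fun e => _ => finF.
have -> : \sum_(e \in [set: edge K]) (r e)%:C * psi e * coboundary h e =
    \sum_(e \in [set: edge K]) (F e + F (eopp e)).
  apply: eq_fsbigr => e _; rewrite /F ehead_opp r_sym psiC1 /coboundary.
  by rewrite mulrBr mulrN mulNr.
rewrite fsum_split//; last exact: finitely_supported_eopp.
have half (y : R[i]) : 2^-1 * (y + y) = y.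
  by rewrite -mulr2n -[y *+ 2]mulr_natl mulKf ?pnatr_eq0.
rewrite fsum_eopp half.
rewrite -fsum_heads//; apply: eq_fsbigr => x _.
by rewrite mulr_fsuml; apply: eq_fsbigr => e; rewrite inE => <-.
Qed.

Lemma green_delta phi f : C1 phi -> finitely_supported phi ->
  l2dot c (delta c r phi) f = 2^-1 * l2dot r phi (coboundary f).
Proof.
move=> phiC1 finphi; rewrite !l2dot_fsum; last 2 first.
- by apply: finitely_supported_sub finphi _ => e phi0;
  rewrite /l2_term phi0 mulr0 mul0r.
- apply: finitely_supported_sub (finitely_supported_delta finphi) _ => x dx0.
  by rewrite /l2_term dx0 mulr0 mul0r.
transitivity (\sum_(x \in [set: V])
    (\sum_(e \in heads K x) (r e)%:C * phi e) * Num.conj (f x)).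
  apply: eq_fsbigr => x _; rewrite /l2_term /delta mulrA -rmorphM/= mulfV
    ?gt_eqF//.
  by rewrite mul1r.
rewrite (sum_by_parts phiC1).
  by congr (_ * _); apply: eq_fsbigr => e _;
    rewrite /l2_term /coboundary rmorphB.
by apply: finitely_supported_sub finphi _ => e phi0; rewrite phi0 mulr0 mul0r.
Qed.

Lemma green_coboundary f psi : C1 psi -> finitely_supported f ->
  2^-1 * l2dot r (coboundary f) psi = l2dot c f (delta c r psi).
Proof.
move=> psiC1 finf.
have finfhead : finitely_supported (fun e : edge K => f (ehead e)).
  by apply: sub_finite_set (finite_edges_meeting K_locally_finite finf) => e
    /=; left.
rewrite !l2dot_fsum; last 2 first.
- by apply: finitely_supported_sub finf _ => x f0;
  rewrite /l2_term f0 mulr0 mul0r.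
- apply: finitely_supported_sub (finitely_supported_coboundary finf) _ => e df0.
  by rewrite /l2_term df0 mulr0 mul0r.
(* Here [delta] stands in the conjugated slot, so summation by parts is applied to the conjugate of
   [psi]. *)
have conjC1 : C1 (fun e => Num.conj (psi e)) by move=> e; rewrite psiC1 rmorphN.
apply: esym.
transitivity (\sum_(x \in [set: V])
    (\sum_(e \in heads K x) (r e)%:C * Num.conj (psi e)) * f x).
  apply: eq_fsbigr => x _; rewrite /l2_term /delta rmorphM/= conj_real.
  rewrite mulrACA -rmorphM/= mulfV ?gt_eqF// mul1r mulrC; congr (_ * _).
  rewrite !(fsbig_finite _ _ (finite_heads K_locally_finite x)) rmorph_sum.
  by apply: eq_bigr => e _; rewrite rmorphM/= conj_real.
rewrite (sum_by_parts conjC1).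
  by congr (_ * _); apply: eq_fsbigr => e _; rewrite /l2_term mulrAC.
by apply: finitely_supported_sub finfhead _ => e ->; rewrite mulr0.
Qed.

Lemma l2_finitely_supported {T : choiceType} (w : T -> R) (g : T -> R[i]) :
  (forall t, 0 < w t) -> finitely_supported g -> l2 w g.
Proof.
move=> w0 fing; apply/l2P => //; pose A := fset_set [set t | g t != 0].
exists (\sum_(t <- A) wsq w g t) => B.
apply: le_trans (ler_sum_fsetS (wsq_ge0 w0 g) (fsubsetUr A B)) _.
rewrite (big_fset_sub_split _ (fsubsetUl A B)) gerDl big_seq big1// => t.
rewrite inE => /andP[tA _]; rewrite /wsq (finitely_supported_outside fing tA).
by rewrite Normc.normc0 expr0n mulr0.
Qed.

Lemma gauss_bonnet_fin (u : cochain K) :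
  cochain_fin R K u -> cochain_fin R K (gauss_bonnet c r u).
Proof.
move=> [fin1 C1u fin2]; split; [exact: finitely_supported_delta|exact:
  C1_coboundary|].
exact: finitely_supported_coboundary.
Qed.

(** [v] is neither finitely supported nor square summable in general: this allows [v] to be a kernel
    element, or its image under [gauss_bonnet]. *)
Lemma gauss_bonnet_green (u v : cochain K) : cochain_fin R K u -> C1 v.2 ->
  cochain_dot c r (gauss_bonnet c r u) v = cochain_dot c r u (gauss_bonnet c r
    v).
Proof.
move=> [fin1 C1u fin2] C1v; rewrite /cochain_dot/= green_delta//
  green_coboundary//.
by rewrite addrC.
Qed.

Lemma cochain_fin_l2 : cochain_fin R K `<=` cochain_l2 c r.
Proof. by move=> u [? ? ?]; split=> //; exact: l2_finitely_supported. Qed.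

(** The carrier of [cochain] with its complex scalar multiplication, which [is_hilbert] requires. *)
Definition cochain_lmod : lmodType R[i] :=
  ((V -> R[i]^o) * (edge K -> R[i]^o))%type.

Lemma delta_linear (a : R[i]) (phi psi : edge K -> R[i]^o) :
  delta c r (a *: phi + psi) = a *: (delta c r phi : V -> R[i]^o) + delta c r
    psi.
Proof.
apply/funext => x; rewrite /delta.
rewrite [RHS](_ : _ = a * ((c x)^-1%:C * \sum_(e \in [set e : edge K | ehead e
  = x]) (r e)%:C * phi e) +
  (c x)^-1%:C * \sum_(e \in [set e : edge K | ehead e = x]) (r e)%:C * psi e)//.
rewrite mulrCA -mulrDr; congr (_ * _).
rewrite !(fsbig_finite _ _ (finite_heads K_locally_finite x)) mulr_sumr
  -big_split.
by apply: eq_bigr => e _ /=; rewrite mulrDr mulrCA.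
Qed.

Lemma gauss_bonnet_linear (a : R[i]) (u v : cochain_lmod) :
  gauss_bonnet c r (a *: u + v) =
  a *: (gauss_bonnet c r u : cochain_lmod) + gauss_bonnet c r v.
Proof.
apply: injective_projections; first exact: (delta_linear a u.2 v.2).
apply/funext => e; rewrite /coboundary.
rewrite [RHS](_ : _ = a * (u.1 (ehead e) - u.1 (etail e)) + (v.1 (ehead e) -
  v.1 (etail e)))//.
rewrite [LHS](_ : _ = a * u.1 (ehead e) + v.1 (ehead e) - (a * u.1 (etail e) +
  v.1 (etail e)))//.
by rewrite mulrBr opprD addrACA.
Qed.

Lemma nsq_cochain (u : cochain_lmod) : nsq (U := cochain_lmod) (cochain_dot c
  r) u =
  nsq (U := V -> R[i]^o) (l2dot c) u.1 + 2^-1 * nsq (U := edge K -> R[i]^o)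
    (l2dot r) u.2.
Proof.
rewrite /nsq /cochain_dot ReD; congr (_ + _).
exact: Re_half.
Qed.

Let hilV := l2_is_hilbert c_gt0.
Let hilE := l2_is_hilbert r_gt0.

Lemma cochain_is_hilbert :
  is_hilbert (U := cochain_lmod) (cochain_l2 c r) (cochain_dot c r).
Proof.
split.
- by split; [exact: hilbert0 hilV|move=> e; rewrite oppr0|exact: hilbert0 hilE].
- move=> u v [u1 uC u2] [v1 vC v2]; split;
  [exact: (hilbertD hilV)| |exact: (hilbertD hilE)].
  move=> e; rewrite [LHS](_ : _ = u.2 (eopp e) + v.2 (eopp e))// uC vC -opprD//.
- move=> a u [u1 uC u2]; split;
  [exact: (hilbertZ hilV)| |exact: (hilbertZ hilE)].
  by move=> e; rewrite [LHS](_ : _ = a * u.2 (eopp e))// uC mulrN.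
- move=> u v z [u1 _ u2] [v1 _ v2] [z1 _ z2]; rewrite /cochain_dot.
  by rewrite (hilbert_dotDl hilV u1 v1 z1) (hilbert_dotDl hilE u2 v2 z2) mulrDr
    addrACA.
- move=> a u v [u1 _ u2] [v1 _ v2]; rewrite /cochain_dot.
  by rewrite (hilbert_dotZl hilV a u1 v1) (hilbert_dotZl hilE a u2 v2) mulrDr
    mulrCA.
- move=> u v [u1 _ u2] [v1 _ v2]; rewrite /cochain_dot.
  rewrite (hilbert_dotC hilV u1 v1) (hilbert_dotC hilE u2 v2) rmorphD rmorphM/=.
  by rewrite fmorphV rmorph_nat.
- move=> u [u1 _ u2]; rewrite nsq_cochain addr_ge0 ?mulr_ge0//.
    exact: (hilbert_nsq_ge0 hilV).
  exact: (hilbert_nsq_ge0 hilE).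
- move=> u [u1 _ u2]; rewrite nsq_cochain => /eqP.
  rewrite paddr_eq0 ?mulr_ge0 ?(hilbert_nsq_ge0 hilV u1) ?(hilbert_nsq_ge0 hilE
    u2)//.
  rewrite mulf_eq0 invr_eq0 pnatr_eq0/= => /andP[/eqP n1 /eqP n2].
  by rewrite [u]surjective_pairing (hilbert_nsq_eq0 hilV u1 n1)
    (hilbert_nsq_eq0 hilE u2 n2).
- move=> u ul2 cu.
  have ul1 n : l2 c (u n).1 by case: (ul2 n).
  have ul2' n : l2 r (u n).2 by case: (ul2 n).
  have D1 m n : 0 <= nsq (U := V -> R[i]^o) (l2dot c) ((u m).1 - (u n).1).
    by apply: (hilbert_nsq_ge0 hilV); exact: (hilbertB hilV).
  have D2 m n : 0 <= nsq (U := edge K -> R[i]^o) (l2dot r) ((u m).2 - (u n).2).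
    by apply: (hilbert_nsq_ge0 hilE); exact: (hilbertB hilE).
  have [f fl2 uf] : exists2 f : V -> R[i]^o, l2 c f & forall e : R, 0 < e ->
      exists N, forall n, (N <= n)%N -> nsq (U := V -> R[i]^o) (l2dot c) ((u
        n).1 - f) <= e.
    apply: (hilbert_complete hilV) => // e /cu[N hN]; exists N => m n Nm Nn.
    have := hN _ _ Nm Nn; rewrite nsq_cochain/=; apply: le_trans.
    by rewrite lerDl mulr_ge0.
  have [phi phil2 uphi] : exists2 phi : edge K -> R[i]^o, l2 r phi & forall e :
    R, 0 < e ->
      exists N, forall n, (N <= n)%N -> nsq (U := edge K -> R[i]^o) (l2dot r)
        ((u n).2 - phi) <= e.
    apply: (hilbert_complete hilE) => // e e0.
    have [|N hN] := cu (2^-1 * e); first by rewrite mulr_gt0.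
    exists N => m n Nm Nn.
    have := hN _ _ Nm Nn; rewrite nsq_cochain/= => h.
    rewrite -(@ler_pM2l _ 2^-1)//; apply: le_trans h.
    by rewrite lerDr.
  (* Antisymmetry is a closed condition: the norm controls the values at [e] and at [eopp e], and
     [(u N).2] is antisymmetric. *)
  have phiC1 : C1 phi.
    move=> e; apply/eqP; rewrite -addr_eq0; apply/eqP/Normc.eq0_normc/eqP.
    rewrite -sqrf_eq0 -(mulrI_eq0 _ (mulfI (lt0r_neq0 (r_gt0 e)))) eq_le.
    rewrite mulr_ge0 ?sqr_ge0 ?(ltW (r_gt0 e))// andbT.
    apply/ler_addgt0Pl => d d0; rewrite addr0.
    have [|N hN] := uphi (d / 4); first by rewrite divr_gt0.
    have hNe e' : r e' * Normc.normc ((u N).2 e' - phi e') ^+ 2 <= d / 4.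
      apply: le_trans (hN _ (leqnn N)).
      exact: (wsq_le_nsq r_gt0 e' (hilbertB hilE (ul2' N) phil2)).
    have := hNe e; have := hNe (eopp e); have [_ uC _] := ul2 N;
      rewrite r_sym uC.
    rewrite !normc_sqr !ReD !ImD !ReN !ImN.
    case: (phi e) (phi (eopp e)) ((u N).2 e) => [a b] [a' b'] [p q] /= h1 h2.
    have re0 := r_gt0 e.
    (* |x + y|^2 <= 2 |x|^2 + 2 |y|^2, with two errors of at most [d / 4], gives [d]. *)
    have : r e * ((a' + a) ^+ 2 + (b' + b) ^+ 2) <=
        2 * (r e * ((- p - a') ^+ 2 + (- q - b') ^+ 2) +
             r e * ((p - a) ^+ 2 + (q - b) ^+ 2)).
      rewrite -mulrDr mulrCA ler_pM2l// -subr_ge0.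
      rewrite (_ : _ - _ = (- p - a' - (p - a)) ^+ 2 + (- q - b' - (q - b)) ^+
        2); last by ring.
      by rewrite addr_ge0 ?sqr_ge0.
    by move=> /le_trans; apply; lra.
  exists (f, phi); first by split.
  move=> e e0; have e20 : 0 < e / 2 by rewrite divr_gt0.
  have [N1 h1] := uf _ e20; have [N2 h2] := uphi _ e0.
  exists (maxn N1 N2) => n; rewrite geq_max => /andP[n1 n2].
  rewrite nsq_cochain/= [leRHS](splitr e) lerD ?h1//.
  by rewrite mulrC ler_pM2r// h2.
Qed.

End green.

(** * Cutoffs *)

Lemma weighted_Cauchy_Schwarz {R : realType} {T : Type} (s : seq T) (w a p : T
  -> R) :
  (forall t, 0 <= w t) ->
  (\sum_(t <- s) w t * a t * p t) ^+ 2 <=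
  (\sum_(t <- s) w t * a t ^+ 2) * (\sum_(t <- s) w t * p t ^+ 2).
Proof.
move=> w0; elim: s => [|t s]; first by rewrite !big_nil expr0n mulr0.
have sq0 (g : T -> R) : 0 <= \sum_(t <- s) w t * g t ^+ 2.
  by apply: sumr_ge0 => i _; rewrite mulr_ge0 ?sqr_ge0.
rewrite !big_cons; move: (sq0 a) (sq0 p).
set A := \sum_(_ <- s) _; set B := \sum_(_ <- s) _; set X := \sum_(_ <- s) _.
move=> A0 B0 XAB; set q := p t; set b := a t; set v := w t.
(* The arithmetic-geometric mean inequality for [A q^2] and [B b^2], since [X ^+ 2 <= A * B]; it is
   compared after squaring to avoid roots. *)
have cross : 2 * X * b * q <= A * q ^+ 2 + B * b ^+ 2.
  apply: le_trans (ler_norm _) _.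
  have L0 : 0 <= A * q ^+ 2 + B * b ^+ 2 by rewrite addr_ge0// mulr_ge0
    ?sqr_ge0.
  rewrite -(@ler_pXn2r _ 2) ?nnegrE ?normr_ge0// real_normK ?num_real//.
  apply: (@le_trans _ _ (4 * (A * B) * (b * q) ^+ 2)).
    rewrite (_ : (2 * X * b * q) ^+ 2 = 4 * X ^+ 2 * (b * q) ^+ 2);
      last by ring.
    by rewrite ler_wpM2r ?sqr_ge0// ler_pM2l.
  rewrite -subr_ge0 (_ : _ - _ = (A * q ^+ 2 - B * b ^+ 2) ^+ 2) ?sqr_ge0//.
  by ring.
rewrite -subr_ge0 (_ : _ - _ = v * (A * q ^+ 2 + B * b ^+ 2 - 2 * X * b * q) +
  (A * B - X ^+ 2)).
  by apply: addr_ge0; [apply: mulr_ge0;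
    [exact: w0|rewrite subr_ge0]|rewrite subr_ge0].
by ring.
Qed.

Lemma weighted_Cauchy_Schwarz_normc {R : realType} {T : choiceType} (s : {fset
  T})
    (w a : T -> R) (z : T -> R[i]) : (forall t, 0 <= w t) ->
  Normc.normc (\sum_(t <- s) (w t * a t)%:C * z t) ^+ 2 <=
  (\sum_(t <- s) w t * a t ^+ 2) * (\sum_(t <- s) wsq w z t).
Proof.
move=> w0; rewrite normc_sqr.
have -> : \sum_(t <- s) wsq w z t = \sum_(t <- s) w t * complex.Re (z t) ^+ 2 +
    \sum_(t <- s) w t * complex.Im (z t) ^+ 2.
  by rewrite -big_split; apply: eq_bigr => t _; rewrite /wsq normc_sqr mulrDr.
rewrite mulrDr; apply: lerD.
  have -> : complex.Re (\sum_(t <- s) (w t * a t)%:C * z t) =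
      \sum_(t <- s) w t * a t * complex.Re (z t).
    by rewrite Re_sum; apply: eq_bigr => t _; exact: Re_realM.
  exact: weighted_Cauchy_Schwarz.
have -> : complex.Im (\sum_(t <- s) (w t * a t)%:C * z t) =
    \sum_(t <- s) w t * a t * complex.Im (z t).
  rewrite Im_sum; apply: eq_bigr => i _.
  by case: (z i) => p q /=; rewrite mul0r addr0.
exact: weighted_Cauchy_Schwarz.
Qed.

Lemma fsum_le {R : realType} {T : choiceType} (y : T -> R) (M : R) :
  psum_bounded y M -> \sum_(t \in [set: T]) y t <= M.
Proof.
move=> yM; case: (pselect (finitely_supported y)) => [finy|infy].
  rewrite (fsbigTE (fset_set [set t | y t != 0])) ?yM// => t.
  exact: finitely_supported_outside.
(* With infinite support the sum has the default value 0, and the empty partial sum shows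
   [0 <= M]. *)
rewrite fsbig_dflt; first by have := yM fset0; rewrite big_seq_fset0.
apply: contra_not infy; apply: sub_finite_set => t /= yt; split=> //.
exact/eqP.
Qed.

Lemma l2_term_le_l2dot {R : realType} {T : choiceType} (w : T -> R)
    (f g : T -> R[i]) (t : T) : finitely_supported f ->
  (forall t, 0 <= complex.Re (l2_term w f g t)) ->
  complex.Re (l2_term w f g t) <= complex.Re (l2dot w f g).
Proof.
move=> finf pos; pose A := (fset_set [set t | f t != 0] `|` [fset t])%fset.
rewrite (@l2dot_finite _ _ w f g A) => [|s]; last first.
  by rewrite in_fsetU negb_or => /andP[+ _]; exact: finitely_supported_outside.
rewrite Re_sum (big_fset_sub_split _ (_ : [fset t] `<=` A)%fset) ?fsubsetUr//.
by rewrite big_seq_fset1 lerDl sumr_ge0// => s _; exact: pos.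
Qed.

Section cutoff.
Context {R : realType} {V : choiceType} (K : graph V).
Context (c : V -> R) (r : edge K -> R).
Hypotheses (c_gt0 : forall v, 0 < c v) (r_gt0 : forall e, 0 < r e).
Hypothesis r_sym : forall e, r (eopp e) = r e.
Hypothesis K_locally_finite : locally_finite K.
Context (chi : V -> R).
Hypothesis chi_fin : finitely_supported chi.
Implicit Types (f : V -> R[i]) (phi : edge K -> R[i]) (u : @cochain R V K).

(* On edges the product of the end values is used, not their mean: at a vertex
   [x] it differs from [chi x ^+ 2] by [chi x * coboundary chi e]. *)
Definition vcut f (x : V) : R[i] := (chi x ^+ 2)%:C * f x.

Definition ecut phi (e : edge K) : R[i] := (chi (ehead e) * chi (etail e))%:C *
  phi e.

Definition cutoff u : @cochain R V K := (vcut u.1, ecut u.2).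

(** The weight m_n of the overview, for a single cutoff function. *)
Definition energy (x : V) : R :=
  (c x)^-1 * \sum_(e \in heads K x) r e * coboundary chi e ^+ 2.

Lemma energy_ge0 x : 0 <= energy x.
Proof.
rewrite mulr_ge0 ?invr_ge0 ?(ltW (c_gt0 x))//; apply: fsumr_ge0 => e _.
by rewrite mulr_ge0 ?sqr_ge0// ltW.
Qed.

Lemma cutoff_fin u : C1 u.2 -> cochain_fin R K (cutoff u).
Proof.
move=> uC; split.
- apply: finitely_supported_sub chi_fin _ => x chi0.
  by rewrite /cutoff/= /vcut chi0 expr0n mul0r.
- move=> e; rewrite /cutoff/= /ecut ehead_opp etail_opp uC mulrN.
  by congr (- (_%:C * _)); exact: mulrC.
- have finh : finitely_supported (fun e : edge K => chi (ehead e)).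
    by apply: sub_finite_set (finite_edges_meeting K_locally_finite chi_fin) =>
      e /=; left.
  apply: finitely_supported_sub finh _ => e chi0.
  by rewrite /cutoff/= /ecut chi0 !mul0r.
Qed.

(** With [S] the sum of [r phi] over the edges into [x] and [P] that of [r (d chi) phi], cutting
    [phi] turns [S] into [chi^2 S - chi P]. The real part of this times the conjugate of [S] is |chi
    S - P/2|^2 - |P|^2/4, and Cauchy-Schwarz bounds |P|^2 by the energy. *)
Lemma delta_cut_vertex phi x :
  - (4^-1 * (energy x * \sum_(e \in heads K x) wsq r phi e)) <=
  complex.Re (l2_term c (delta c r (ecut phi)) (delta c r phi) x).
Proof.
have finx := finite_heads K_locally_finite x.
rewrite /l2_term /energy /delta !fsbig_finite//.
set A := fset_set _.
have AP e : e \in A -> ehead e = x by rewrite in_fset_set// inE.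
pose S := \sum_(e <- A) (r e)%:C * phi e.
pose P := \sum_(e <- A) (r e * coboundary chi e)%:C * phi e.
have -> : \sum_(e <- A) (r e)%:C * ecut phi e =
    (chi x ^+ 2)%:C * S - (chi x)%:C * P.
  rewrite !mulr_sumr -sumrB; apply: eq_big_seq => e /AP ex.
  rewrite /ecut /coboundary ex !rmorphM rmorphB ?rmorphXn ?rmorphM/=; ring.
rewrite -/S [Num.conj _]rmorphM/= conj_real.
have -> : (c x)%:C * ((c x)^-1%:C * ((chi x ^+ 2)%:C * S - (chi x)%:C * P)) *
    ((c x)^-1%:C * Num.conj S) =
    (c x)^-1%:C * (((chi x ^+ 2)%:C * S - (chi x)%:C * P) * Num.conj S).
  by rewrite (mulrA (c x)%:C) -rmorphM/= mulfV ?gt_eqF// mul1r mulrCA.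
rewrite Re_realM -mulrA mulrCA -mulrN ler_pM2l ?invr_gt0//.
have CS := weighted_Cauchy_Schwarz_normc A (coboundary chi) phi (fun e => ltW
  (r_gt0 e)).
rewrite lerNl; apply: (@le_trans _ _ (4^-1 * Normc.normc P ^+ 2)); last first.
  by rewrite ler_pM2l ?invr_gt0.
rewrite normc_sqr -subr_ge0; case: S P {CS} => [s1 s2] [p1 p2] /=.
set z := chi x; rewrite (_ : _ - _ = (z * s1 - p1 / 2) ^+ 2 + (z * s2 - p2 / 2)
  ^+ 2).
  by rewrite addr_ge0 ?sqr_ge0.
by field.
Qed.

Lemma delta_cut_lower phi M :
  C1 phi -> psum_bounded (fun e => energy (ehead e) * wsq r phi e) M ->
  - (4^-1 * M) <= complex.Re (l2dot c (delta c r (ecut phi)) (delta c r phi)).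
Proof.
move=> phiC HM.
(* The zero vertex part is a dummy; only the finite support of [ecut phi] is extracted. *)
have [_ _ fin2] := @cutoff_fin (0, phi) phiC.
have finD := finitely_supported_delta c r fin2.
rewrite (@l2dot_finite _ _ _ _ _ (fset_set [set x | delta c r (ecut phi) x !=
  0])); last first.
  by move=> x; exact: finitely_supported_outside.
rewrite Re_sum; set W := fset_set _.
apply: (@le_trans _ _ (\sum_(x <- W) - (4^-1 * (energy x * \sum_(e \in heads K
  x) wsq r phi e)))).
  rewrite sumrN lerN2 -mulr_sumr ler_pM2l ?invr_gt0//.
  rewrite (eq_bigr (fun x => \sum_(e \in heads K x) energy (ehead e) * wsq r
    phi e)).
    by rewrite sum_heads.
  by move=> x _; rewrite mulr_fsumr; apply: eq_fsbigr => e; rewrite inE => ->.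
by apply: ler_sum => x _; exact: delta_cut_vertex.
Qed.

(** For end values F, G of [f] and a, b of [chi], the real part of (a^2 F - b^2 G) times the
    conjugate of F - G is |aF - bG|^2 - (a - b)^2 Re (F conj G), and Re (F conj G) = (|F|^2 + |G|^2
    - |F - G|^2)/2. *)
Lemma coboundary_cut_edge f e :
  - (2^-1 * (r e * coboundary chi e ^+ 2 *
     (Normc.normc (f (ehead e)) ^+ 2 + Normc.normc (f (etail e)) ^+ 2))) <=
  complex.Re (l2_term r (coboundary (vcut f)) (coboundary f) e).
Proof.
rewrite /l2_term /coboundary /vcut -!mulrA Re_realM mulrCA -mulrN ler_pM2l//.
rewrite !normc_sqr; move: (chi _) (chi _) (f _) (f _) => a b [p q] [s t] /=.
rewrite -subr_ge0 opprK [leRHS](_ : _ = (a * p - b * s) ^+ 2 + (a * q - b * t)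
  ^+ 2 +
  2^-1 * (a - b) ^+ 2 * ((p - s) ^+ 2 + (q - t) ^+ 2)); last by field.
apply: addr_ge0; first by rewrite addr_ge0 ?sqr_ge0.
by rewrite mulr_ge0 ?addr_ge0 ?sqr_ge0// pmulr_rge0 ?invr_gt0// sqr_ge0.
Qed.

Lemma coboundary_cut_lower f M :
  psum_bounded (fun x => energy x * wsq c f x) M ->
  - M <= complex.Re (l2dot r (coboundary (vcut f)) (coboundary f)).
Proof.
move=> HM.
have finE := finite_edges_meeting K_locally_finite chi_fin.
pose E := fset_set [set e : edge K | chi (ehead e) != 0 \/ chi (etail e) != 0].
have EP e : e \notin E -> chi (ehead e) = 0 /\ chi (etail e) = 0.
  rewrite in_fset_set// notin_setE/= => /not_orP[/negP/negPn/eqP ->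
    /negP/negPn/eqP ->].
  by [].
rewrite (@l2dot_finite _ _ _ _ _ E); last first.
  by move=> e /EP[h t]; rewrite /coboundary /vcut h t expr0n !mul0r subrr.
(* [Q] keeps the contribution of the head. That of the tail is [Q (eopp e)], so the half-sum over
   all edges is the sum of [Q], which regroups by heads into the energy. *)
pose Q e := r e * coboundary chi e ^+ 2 * Normc.normc (f (ehead e)) ^+ 2.
have Qopp e : Q (eopp e) = r e * coboundary chi e ^+ 2 * Normc.normc (f (etail
  e)) ^+ 2.
  by rewrite /Q r_sym /coboundary ehead_opp etail_opp -opprB sqrrN.
have finQ : finitely_supported Q.
  apply: finitely_supported_sub (finitely_supported_coboundary K_locally_finite
    chi_fin) _.
  by move=> e d0; rewrite /Q d0 expr0n mulr0 mul0r.
rewrite Re_sum; apply: (@le_trans _ _ (\sum_(e <- E) - (2^-1 * (Q e + Q (eopp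
  e))))); last first.
  by apply: ler_sum => e _; rewrite Qopp /Q -mulrDr; exact: coboundary_cut_edge.
rewrite sumrN lerN2 -mulr_sumr.
rewrite -(@fsbigTE _ _ _ _ E (fun e => Q e + Q (eopp e))); last first.
  by move=> e /EP[h t]; rewrite Qopp /Q /coboundary h t subrr expr0n mulr0
    !mul0r addr0.
rewrite fsum_split//; last exact: (finitely_supported_eopp finQ).
rewrite fsum_eopp (_ : forall y : R, 2^-1 * (y + y) = y); last by move=> y;
  field.
rewrite -fsum_heads//; apply: le_trans (fsum_le HM).
rewrite le_eqVlt; apply/orP; left; apply/eqP; apply: eq_fsbigr => x _.
rewrite /energy /wsq mulrACA mulVf ?gt_eqF// mul1r mulr_fsuml.
by apply: eq_fsbigr => e; rewrite inE => ex; rewrite /Q ex.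
Qed.

Lemma gauss_bonnet_cut_lower u M : C1 u.2 ->
  psum_bounded (fun x => energy x * wsq c u.1 x) M ->
  psum_bounded (fun e => energy (ehead e) * wsq r u.2 e) M ->
  - M <= complex.Re (cochain_dot c r (gauss_bonnet c r (cutoff u))
    (gauss_bonnet c r u)).
Proof.
move=> uC H1 H2; rewrite /cochain_dot ReD Re_half.
have h1 := coboundary_cut_lower H1; have h2 := delta_cut_lower uC H2.
have M0 : 0 <= M by have := H1 fset0; rewrite big_seq_fset0.
(* The losses are [M / 4] from [delta] and, with the factor 1/2 of the edge product, [M / 2] from
   the coboundary: at most [M] together. *)
move: h1 h2; rewrite /=; set p := complex.Re _; set q := complex.Re _ => *; lra.
Qed.

End cutoff.

Lemma Re_l2_term_scale {R : realType} {T : choiceType} (w a : T -> R)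
    (f : T -> R[i]) t :
  complex.Re (l2_term w (fun s => (a s)%:C * f s) f t) = a t * wsq w f t.
Proof.
rewrite -l2_term_diag -Re_realM /l2_term; congr complex.Re.
by rewrite -!mulrA mulrCA.
Qed.

(** * Triviality of the kernel and density of finitely supported cochains *)

Section chi_completeness.
Context {R : realType} {V : choiceType} (K : graph V).
Context (c : V -> R) (r : edge K -> R).
Hypotheses (c_gt0 : forall v, 0 < c v) (r_gt0 : forall e, 0 < r e).
Hypothesis r_sym : forall e, r (eopp e) = r e.
Hypothesis K_locally_finite : locally_finite K.
Context (chi : nat -> V -> R) (M : R).
Hypothesis chi_fin : forall n, finitely_supported (chi n).
Hypothesis chi01 : forall n v, 0 <= chi n v <= 1.
Hypothesis chi_ev1 : forall v, exists N, forall n, (N <= n)%N -> chi n v = 1.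
Hypothesis energy_le : forall n v, energy c r (chi n) v <= M.

Lemma energy_ev0 x : exists N, forall n, (N <= n)%N -> energy c r (chi n) x = 0.
Proof.
have /choice [N hN] := chi_ev1; have finx := finite_heads K_locally_finite x.
(* From this index on, [chi n] is 1 at [x] and at every neighbour, so all differences at [x]
   vanish. *)
exists (maxn (N x) (\max_(e <- fset_set (heads K x)) N (etail e))) => n.
rewrite geq_max => /andP[Nx Nt]; rewrite /energy fsbig1 ?mulr0// => e ex.
rewrite /coboundary ex (hN _ _ Nx) hN ?subrr ?expr0n ?mulr0//.
apply: leq_trans Nt; apply: (@leq_bigmax_seq _ _ xpredT (fun e => N (etail e)))
  => //.
by rewrite in_fset_set// inE.
Qed.

(** The map [h] lets one statement serve vertices, with [h] the identity, and edges, with [h] the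
    head. *)
Lemma energy_vanishing {T : choiceType} (w : T -> R) (g : T -> R[i]) (h : T ->
  V) :
  (forall t, 0 < w t) -> l2 w g -> forall e : R, 0 < e ->
  exists N, forall n, (N <= n)%N ->
    psum_bounded (fun t => energy c r (chi n) (h t) * wsq w g t) e.
Proof.
move=> w0 /(l2P w0)[B gB]; apply: (dominated_tail (C := M) (wsq_ge0 w0 g) gB)
  => [n t|t].
  by rewrite energy_ge0// energy_le.
exact: energy_ev0.
Qed.

Lemma cutoff_dot_small (u : @cochain R V K) : cochain_l2 c r u ->
  (forall q, cochain_fin R K q ->
     cochain_dot c r (laplacian c r q) u = - cochain_dot c r q u) ->
  forall e : R, 0 < e -> exists N, forall n, (N <= n)%N ->
    complex.Re (cochain_dot c r (cutoff (chi n) u) u) <= e.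
Proof.
move=> [u1 uC u2] uker e e0.
have [N1 h1] := energy_vanishing id c_gt0 u1 e0.
have [N2 h2] := energy_vanishing (@ehead V K) r_gt0 u2 e0.
exists (maxn N1 N2) => n; rewrite geq_max => /andP[n1 n2].
have fin := cutoff_fin K_locally_finite (chi_fin n) uC.
rewrite -lerN2 -ReN -(uker _ fin) /laplacian gauss_bonnet_green//; last first.
  exact: gauss_bonnet_fin.
by apply: gauss_bonnet_cut_lower => //; [exact: h1|exact: h2].
Qed.

Lemma cochain_kernel (u : @cochain R V K) : cochain_l2 c r u ->
  (forall q, cochain_fin R K q ->
     cochain_dot c r (laplacian c r q) u = - cochain_dot c r q u) -> u = 0.
Proof.
move=> ul2 uker; have small := cutoff_dot_small ul2 uker;
  have [u1 uC u2] := ul2.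
have termV n x : complex.Re (l2_term c (vcut (chi n) u.1) u.1 x) = chi n x ^+ 2
  * wsq c u.1 x.
  exact: Re_l2_term_scale.
have termE n e : complex.Re (l2_term r (ecut (chi n) u.2) u.2 e) =
    chi n (ehead e) * chi n (etail e) * wsq r u.2 e.
  exact: Re_l2_term_scale.
have chi0 n x : 0 <= chi n x by case/andP: (chi01 n x).
have termV0 n x : 0 <= complex.Re (l2_term c (vcut (chi n) u.1) u.1 x).
  by rewrite termV mulr_ge0 ?sqr_ge0 ?wsq_ge0.
have termE0 n e : 0 <= complex.Re (l2_term r (ecut (chi n) u.2) u.2 e).
  by rewrite termE; apply: mulr_ge0; [apply: mulr_ge0;
    exact: chi0|exact: wsq_ge0].
(* Both parts of <q_n, u> are sums of nonnegative terms, so each term is bounded by its sum and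
   neither part can cancel the other. *)
have lower n : [/\ 0 <= complex.Re (l2dot c (vcut (chi n) u.1) u.1),
    0 <= complex.Re (l2dot r (ecut (chi n) u.2) u.2),
    forall x, chi n x ^+ 2 * wsq c u.1 x <= complex.Re (l2dot c (vcut (chi n)
      u.1) u.1) &
    forall e, chi n (ehead e) * chi n (etail e) * wsq r u.2 e <=
      complex.Re (l2dot r (ecut (chi n) u.2) u.2)].
  have [fin1 _ fin2] := cutoff_fin K_locally_finite (chi_fin n) uC.
  have dot0 (T : choiceType) (w : T -> R) (f g : T -> R[i]) :
    finitely_supported f ->
      (forall t, 0 <= complex.Re (l2_term w f g t)) -> 0 <= complex.Re (l2dot w
        f g).
    move=> finf pos; rewrite (@l2dot_finite _ _ w f g (fset_set [set t | f t !=
      0])).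
      by rewrite Re_sum sumr_ge0// => t _; exact: pos.
    by move=> t; exact: finitely_supported_outside.
  split; [exact: dot0|exact: dot0|move=> x; rewrite -termV;
    exact: l2_term_le_l2dot|].
  by move=> e; rewrite -termE; exact: l2_term_le_l2dot.
have wsq0 (T : choiceType) (w : T -> R) (g : T -> R[i]) t : (forall t, 0 < w t)
  ->
    (forall e, 0 < e -> wsq w g t <= e) -> g t = 0.
  move=> w0 le_e; have : wsq w g t == 0.
    rewrite eq_le wsq_ge0// andbT; apply/ler_addgt0Pl => e e0.
    by rewrite addr0; exact: le_e.
  rewrite mulf_eq0 (gt_eqF (w0 t))/= sqrf_eq0 => /eqP; exact: Normc.eq0_normc.
apply: injective_projections; apply/funext => t.
  apply: (wsq0 _ c) => // e e0; have [N hN] := small _ e0;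
    have [P hP] := chi_ev1 t.
  pose n := maxn N P; have [_ dE /(_ t) + _] := lower n.
  rewrite hP ?leq_maxr// expr1n mul1r => /le_trans; apply.
  apply: le_trans (hN n (leq_maxl _ _)).
  by rewrite /cochain_dot ReD Re_half lerDl mulr_ge0.
(* The halved tolerance offsets the factor 1/2 of the edge product. *)
apply: (wsq0 _ r) => // e e0; have e20 : 0 < 2^-1 * e by rewrite mulr_gt0.
have [N hN] := small _ e20.
have [P hP] := chi_ev1 (ehead t); have [Q hQ] := chi_ev1 (etail t).
pose n := maxn N (maxn P Q); have [dV _ _ /(_ t)] := lower n.
rewrite hP; last by rewrite /n !leq_max leqnn orbT.
rewrite hQ; last by rewrite /n !leq_max leqnn !orbT.
rewrite !mul1r => /le_trans; apply; rewrite -(@ler_pM2l _ 2^-1)//.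
apply: le_trans (hN n (leq_maxl _ _)).
by rewrite /cochain_dot ReD Re_half lerDr.
Qed.

(** The approximants are the cutoffs of [u]: the error carries a factor (1 - a_n)^2 that lies in
    [0, 1] and is eventually 0 at each point, so [dominated_tail] applies. *)
Lemma cochain_fin_dense : dense_in (cochain_l2 c r) (cochain_dot c r)
  (cochain_fin R K).
Proof.
have hil := cochain_is_hilbert c_gt0 r_gt0 r_sym.
split; first exact: cochain_fin_l2.
move=> u ul2 e e0; have [u1 uC u2] := ul2.
have cut_small (T : choiceType) (w : T -> R) (g : T -> R[i]) (a : nat -> T ->
  R) :
    (forall t, 0 < w t) -> l2 w g -> (forall n t, 0 <= a n t <= 1) ->
    (forall t, exists N, forall n, (N <= n)%N -> a n t = 1) ->
    forall d : R, 0 < d -> exists N, forall n, (N <= n)%N ->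
      psum_bounded (wsq w (fun t => g t - (a n t)%:C * g t)) d.
  move=> w0 /(l2P w0)[B gB] a01 a1 d d0.
  have [|t|N hN] := @dominated_tail _ _ (wsq w g) (fun n t => (1 - a n t) ^+ 2)
    B 1
      (wsq_ge0 w0 g) gB _ _ d d0.
  - move=> n t; have /andP[a0 ale] := a01 n t.
    by rewrite sqr_ge0 expr_le1 ?subr_ge0// gerBl.
  - by have [N hN] := a1 t; exists N => n /hN ->; rewrite subrr expr0n.
  exists N => n /hN h A; apply: le_trans (h A); apply: ler_sum => t _.
  rewrite /wsq (_ : g t - _ = (1 - a n t)%:C * g t).
    rewrite Normc.normcM exprMn mulrCA (_ : Normc.normc (1 - a n t)%:C ^+ 2 =
      (1 - a n t) ^+ 2)//.
    by rewrite normc_sqr/= expr0n addr0.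
  by rewrite rmorphB mulrBl mul1r.
have e20 : 0 < e ^+ 2 / 2 by rewrite divr_gt0// exprn_gt0.
have v01 n x : 0 <= chi n x ^+ 2 <= 1.
  by have /andP[? ?] := chi01 n x; rewrite sqr_ge0 expr_le1.
have v1 x : exists N, forall n, (N <= n)%N -> chi n x ^+ 2 = 1.
  by have [N hN] := chi_ev1 x; exists N => n /hN ->; rewrite expr1n.
have e01 n (f : edge K) : 0 <= chi n (ehead f) * chi n (etail f) <= 1.
  have /andP[? ?] := chi01 n (ehead f); have /andP[? ?] := chi01 n (etail f).
  by rewrite mulr_ge0// mulr_ile1.
have e1 (f : edge K) : exists N, forall n, (N <= n)%N ->
    chi n (ehead f) * chi n (etail f) = 1.
  have [N hN] := chi_ev1 (ehead f); have [P hP] := chi_ev1 (etail f).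
  by exists (maxn N P) => n; rewrite geq_max => /andP[/hN -> /hP ->];
    rewrite mulr1.
have [N1 h1] := cut_small _ c u.1 _ c_gt0 u1 v01 v1 _ e20.
have [N2 h2] := cut_small _ r u.2 _ r_gt0 u2 e01 e1 _ e20.
pose n := maxn N1 N2; have fin := cutoff_fin K_locally_finite (chi_fin n) uC.
exists (cutoff (chi n) u) => //.
have cl2 := cochain_fin_l2 c_gt0 r_gt0 fin.
have [d1 _ d2] : cochain_l2 c r (u - cutoff (chi n) u) by exact: (hilbertB hil).
rewrite (@hnorm_lt R (cochain_lmod K))// nsq_cochain.
have := nsq_le c_gt0 d1 (h1 n (leq_maxl _ _)).
have := nsq_le r_gt0 d2 (h2 n (leq_maxr _ _)).
have : 0 < e ^+ 2 by rewrite exprn_gt0.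
set p := nsq _ _; set q := nsq _ _; set d := e ^+ 2 => *; lra.
Qed.

End chi_completeness.

Theorem corollary14 (R : realType) (V : choiceType) (K : graph V)
    (c : V -> R) (r : edge K -> R)
    (c_gt0 : forall v, 0 < c v) (r_gt0 : forall e, 0 < r e)
    (r_sym : forall e, r (eopp e) = r e)
    (K_connected : connected_graph K) (K_locally_finite : locally_finite K)
    (K_chi_complete : chi_complete c r) :
  essentially_selfadjoint (cochain_l2 c r) (cochain_dot c r)
    (op_graph (cochain_fin R K) (laplacian c r)).
Proof.
have [B [chi [[finB incrB coverB] chi_fin01 chiB [M M0 chiM]]]] :=
  K_chi_complete.
have chi_fin n : finitely_supported (chi n) by case: (chi_fin01 n).
have chi01 n v : 0 <= chi n v <= 1 by case: (chi_fin01 n).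
have chi_ev1 v : exists N, forall n, (N <= n)%N -> chi n v = 1.
  have [N _ BN] : (\bigcup_n B n) v by rewrite coverB.
  by exists N => n Nn; apply: chiB; exact: incrB BN.
(* The bound in [chi_complete] runs over all edges at [v]; discarding the outgoing ones only
   decreases a sum of nonnegative terms. *)
have energyM n v : energy c r (chi n) v <= M.
  apply: le_trans (chiM n v); rewrite ler_pM2l ?invr_gt0//.
  have finh := finite_heads K_locally_finite v.
  have finv := K_locally_finite v.
  rewrite !fsbig_finite//; apply: ler_sum_fsetS.
    by move=> e; rewrite mulr_ge0 ?sqr_ge0// ltW.
  apply/fsubsetP => e; rewrite !in_fset_set//.
  by rewrite !inE; left.
have gb_fin q : cochain_fin R K q -> cochain_fin R K (gauss_bonnet c r q).
  exact: gauss_bonnet_fin.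
have lap_fin q : cochain_fin R K q -> cochain_fin R K (laplacian c r q).
  by move=> qfin; exact: gb_fin (gb_fin _ qfin).
have fin_C1 q : cochain_fin R K q -> C1 q.2 by case.
have hil := cochain_is_hilbert c_gt0 r_gt0 r_sym.
apply: (@positive_essentially_selfadjoint _ (cochain_lmod K)) => //.
- exact: (cochain_fin_dense c_gt0 r_gt0 r_sym K_locally_finite chi_fin chi01
  chi_ev1).
- split; [|by move=> e; rewrite oppr0|].
  + by apply: sub_finite_set (finite_set0 V) => x /=; rewrite eqxx.
  + by apply: sub_finite_set (finite_set0 (edge K)) => x /=; rewrite eqxx.
- move=> a u v [u1 uC u2] [v1 vC v2].
  have lin (T : choiceType) (f g : T -> R[i]^o) : finitely_supported f ->
      finitely_supported g -> finitely_supported (a *: f + g).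
    move=> finf fing.
    have finU : finite_set ([set t | f t != 0] `|` [set t | g t != 0]) by
      rewrite finite_setU.
    apply: sub_finite_set finU => t /= t0.
    apply: contrapT => /not_orP[/negP/negPn/eqP f0 /negP/negPn/eqP g0].
    by move: t0; rewrite [X in X != 0](_ : _ = a * f t + g t)// f0 g0 mulr0
      addr0 eqxx.
  split; [exact: lin| |exact: lin].
  move=> e; rewrite [LHS](_ : _ = a * u.2 (eopp e) + v.2 (eopp e))// uC vC.
  by rewrite mulrN -opprD.
- by move=> u /lap_fin; exact: cochain_fin_l2.
- by move=> a u v _ _; rewrite /laplacian !gauss_bonnet_linear.
- move=> u v ufin vfin; rewrite /laplacian.
  have C1v := fin_C1 _ vfin; have C1dv := fin_C1 _ (gb_fin _ vfin).
  by rewrite gauss_bonnet_green ?gauss_bonnet_green//; exact: gb_fin.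
(* Positivity: by Green's formula the quadratic form is the squared norm of [D u]. *)
- move=> u ufin; have gufin := gb_fin _ ufin; rewrite /laplacian.
  rewrite gauss_bonnet_green//; last exact: fin_C1.
  by apply: (hilbert_nsq_ge0 hil); exact: cochain_fin_l2.
- exact: (cochain_kernel c_gt0 r_gt0 r_sym K_locally_finite chi_fin chi01
  chi_ev1 energyM).
Qed.
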